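(* Let $H$ be a braided Hopf algebra with braid $c$ and let $(i\colon A\hookrightarrow B,s)$ be an $H$-extension. The following assertions are equivalent: (1) $(i,s)$ is cleft. (2) $(i,s)$ is $H$-Galois with a normal basis. (3) There is a crossed product $A\#_{\rho,\sigma}^{s_A} H$, with convolution invertible cocycle $\sigma\colon H\otimes^c H\to A$, and a right $H$-comodule algebra isomorphism $(B,s)\longrightarrow (A\#_{\rho,\sigma}^{s_A} H,\widehat{s_A})$, which is also left $A$-linear. Furthermore, if $\gamma$ is a cleft map of $(i,s)$ with $\gamma(1_H)=1_B$, then (4) The map $\phi\colon (A\otimes H,\widehat{s_A})\longrightarrow (B,s)$, defined by $\phi(a\otimes h):=i(a)\gamma(h)$, is a normal basis of $B$. (5) The weak action $\rho$ and the cocycle $\sigma$ (associated with $\gamma$) are given by $$ i\circ \rho= \mu_B\circ (\mu_B\otimes B)\circ(\gamma\otimes i\otimes \gamma^{-1})\circ (H\otimes s_A)\circ(\Delta \otimes A) $$ and $$ i\circ \sigma=\mu_B\circ (\mu_B\otimes \gamma^{-1})\circ(\gamma\otimes\gamma\otimes \mu_H) \circ \Delta_{H\otimes^c H}, $$ where $\gamma^{-1}$ is the convolution inverse of $\gamma$.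
   Context: $k$ is a field, all maps are $k$-linear, $\otimes=\otimes_k$, and the name of a space also denotes its identity map. Algebras are associative unital, coalgebras coassociative counital; $\mu,\eta,\Delta,\epsilon$ denote multiplication, unit, comultiplication, counit ($\Delta=\Delta_H$ when no subscript is written). Compatibility: for a map $c\colon V\otimes W\to W\otimes V$, if $V$ is an algebra, $c$ is compatible with it if $c\circ(\eta\otimes W)=W\otimes\eta$ and $c\circ(\mu\otimes W)=(W\otimes\mu)\circ(c\otimes V)\circ(V\otimes c)$; if $V$ is a coalgebra, $c$ is compatible with it if $(W\otimes\epsilon)\circ c=\epsilon\otimes W$ and $(W\otimes\Delta)\circ c=(c\otimes V)\circ(V\otimes c)\circ(\Delta\otimes W)$; similarly on the side of $W$. A braided bialgebra is a space $H$ with an algebra structure, a coalgebra structure and a bijective solution $c\in\mathrm{Aut}_k(H\otimes H)$ of the braid equation (the braid), compatible (on both sides) with the algebra and coalgebra structures of $H$, such that $\eta$ is a coalgebra morphism, $\epsilon$ is an algebra morphism and $\Delta\circ\mu=(\mu\otimes\mu)\circ(H\otimes c\otimes H)\circ(\Delta\otimes\Delta)$. It is a braided Hopf algebra if $\mathrm{id}_H$ has a convolution inverse $S$. $H\otimes^c H$ denotes the coalgebra $H\otimes H$ with counit $\epsilon\otimes\epsilon$ and comultiplication $\Delta_{H\otimes^c H}:=(H\otimes c\otimes H)\circ(\Delta\otimes\Delta)$. A left $H$-space $(V,s)$ is a space $V$ with a bijective map $s\colon H\otimes V\to V\otimes H$ compatible with the algebra and coalgebra structures of $H$ and satisfying $(s\otimes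 H)\circ(H\otimes s)\circ(c\otimes V)=(V\otimes c)\circ(s\otimes H)\circ(H\otimes s)$. If $A$ is an algebra, $s$ is a left transposition of $H$ on $A$ if $(A,s)$ is a left $H$-space and $s$ is compatible with the algebra structure of $A$. A right $H$-comodule algebra $(B,s)$ is an algebra $B$ which is a right $H$-comodule with coaction $\nu\colon B\to B\otimes H$, with a left transposition $s$ of $H$ on the algebra $B$, such that $(\nu\otimes H)\circ s=(B\otimes c)\circ(s\otimes H)\circ(H\otimes\nu)$, $\nu\circ\mu_B=(\mu_B\otimes\mu_H)\circ(B\otimes s\otimes H)\circ(\nu\otimes\nu)$ and $\nu(1_B)=1_B\otimes1_H$. A morphism $(B,s)\to(B',s')$ of right $H$-comodule algebras is an $H$-colinear algebra morphism $f$ with $(f\otimes H)\circ s=s'\circ(H\otimes f)$. Put $B^{\mathrm{coH}}=\{b\in B:\nu(b)=b\otimes1_H\}$. An $H$-extension $(i\colon A\hookrightarrow B,s)$ is a right $H$-comodule algebra $(B,s)$ with an injective algebra map $i\colon A\to B$ such that $i(A)=B^{\mathrm{coH}}$; $B$ is an $A$-bimodule via $i$. Then $s$ induces a left transposition $s_A\colon H\otimes A\to A\otimes H$, characterized by $(i\otimes H)\circ s_A=s\circ(H\otimes i)$. Set $\widehat{s_A}:=(A\otimes c)\circ(s_A\otimes H)\colon H\otimes A\otimes H\to A\otimes H\otimes H$. The extension is cleft if there is a convolution invertible map $\gamma\colon H\to B$ (convolution $f*g=\mu_B\circ(f\otimes g)\circ\Delta$, unit $\eta_B\circ\epsilon$)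 which is right $H$-colinear and satisfies $(\gamma\otimes H)\circ c=s\circ(H\otimes\gamma)$; such a $\gamma$ is called a cleft map. It is $H$-Galois if the map $\beta_B\colon B\otimes_A B\to B\otimes H$, $\beta_B(b\otimes b')=(b\otimes 1_H)\nu(b')$, is bijective. A normal basis of $B$ is a left $A$-linear and right $H$-colinear isomorphism $\phi\colon(A\otimes H,\widehat{s_A})\to(B,s)$, where $A\otimes H$ has coaction $A\otimes\Delta$ (as a morphism of such pairs, $\phi$ satisfies $(\phi\otimes H)\circ\widehat{s_A}=s\circ(H\otimes\phi)$). Crossed products: a weak action of $H$ on $(A,s_A)$ is a map $\rho\colon H\otimes A\to A$ such that $\rho(1_H\otimes a)=a$, $\rho(h\otimes 1_A)=\epsilon(h)1_A$, $s_A\circ(H\otimes\rho)=(\rho\otimes H)\circ(H\otimes s_A)\circ(c\otimes A)$ and $\rho\circ(H\otimes\mu_A)=\mu_A\circ(\rho\otimes\rho)\circ(H\otimes s_A\otimes A)\circ(\Delta\otimes A\otimes A)$. A map $\sigma\colon H\otimes H\to A$ is normal if $\sigma(1_H\otimes h)=\sigma(h\otimes1_H)=\epsilon(h)1_A$; it is compatible with $s_A$ if $(\sigma\otimes H)\circ(H\otimes c)\circ(c\otimes H)=s_A\circ(H\otimes\sigma)$; it is a cocycle if $$\mu_A\circ(\rho\otimes\sigma)\circ(H\otimes\sigma\otimes H\otimes\mu_H)\circ\Delta_3=\mu_A\circ(A\otimes\sigma)\circ(\sigma\otimes\mu_H\otimes H)\circ(\Delta_{H\otimes^cH}\otimes H),$$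 where $\Delta_3:=(H\otimes H\otimes c\otimes H\otimes H)\circ(H\otimes c\otimes c\otimes H)\circ(\Delta\otimes\Delta\otimes\Delta)$; and it satisfies the twisted module condition if $$\mu_A\circ(\rho\otimes\sigma)\circ(H\otimes\rho\otimes H\otimes H)\circ(H\otimes H\otimes s_A\otimes H)\circ(H\otimes H\otimes H\otimes s_A)\circ(\Delta_{H\otimes^cH}\otimes A)=\mu_A\circ(A\otimes\rho)\circ(\sigma\otimes\mu_H\otimes A)\circ(\Delta_{H\otimes^cH}\otimes A).$$ Given a weak action $\rho$ of $H$ on $(A,s_A)$ and a normal cocycle $\sigma$ compatible with $s_A$ that satisfies the twisted module condition, the crossed product $A\#_{\rho,\sigma}^{s_A}H$ is the (associative, with unit $1_A\otimes 1_H$) algebra with underlying space $A\otimes H$ and multiplication $(\mu_A\otimes H)\circ(\mu_A\otimes\mathcal F)\circ(A\otimes\chi\otimes H)$, where $\chi:=(\rho\otimes H)\circ(H\otimes s_A)\circ(\Delta\otimes A)$ and $\mathcal F:=(\sigma\otimes\mu_H)\circ\Delta_{H\otimes^cH}$. With the transposition $\widehat{s_A}$ and the coaction $A\otimes\Delta$ it is a right $H$-comodule algebra; it is a left $A$-module by multiplication on the first factor. Convolution invertibility of $\sigma$ is with respect to the coalgebra $H\otimes^cH$ and the algebra $A$. In item (5), the weak action and the cocycle associated with $\gamma$ are, with $\phi$ as in item (4), $$\rho(h\otimes a):=(A\otimes\epsilon)\circ\phi^{-1}(\gamma(h)i(a)),\qquad \sigma(h\otimes l):=(A\otimes\epsilon)\circ\phi^{-1}(\gamma(h)\gamma(l));$$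 for these, $\phi\colon A\#_{\rho,\sigma}^{s_A}H\to B$ is an algebra isomorphism. *)

(* Defs.v *)
From HB Require Import structures.
From mathcomp Require Import all_boot ssralg generic_quotient ring_quotient.
From mathcomp Require Import boolp.
From mathcomp Require Import freeg.

Set Implicit Arguments.
Unset Strict Implicit.
Unset Printing Implicit Defensive.

Import GRing.Theory.
Import Quotient.

Local Open Scope ring_scope.
Local Open Scope quotient_scope.

Section LinearMap.
Variables (k : fieldType) (U V : lmodType k) (f : U -> V) (fP : linear f).
HB.instance Definition _ := GRing.isLinear.Build k U V _ f fP.
Definition linmap : {linear U -> V} := f.
End LinearMap.

(* The quotient of V by the submodule spanned by G. *)
Section QuotientModule.
Variables (k : fieldType) (V : lmodType k) (G : V -> Prop).

Definition submodule (S : V -> Prop) : Prop :=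
  S 0 /\ forall (a : k) (u v : V), S u -> S v -> S (a *: u + v).

Definition in_span (v : V) : Prop :=
  forall S : V -> Prop, submodule S -> (forall g, G g -> S g) -> S v.

Definition span_pred : {pred V} := fun v => `[< in_span v >].

Lemma span_predP (v : V) : reflect (in_span v) (v \in span_pred).
Proof. exact: asboolP. Qed.

Lemma in_span_submodule : submodule in_span.
Proof.
split=> [S [S0 _] _|a u v hu hv S hS hG]; first exact: S0.
exact: (hS.2 a u v (hu S hS hG) (hv S hS hG)).
Qed.

Lemma span_predZ (a : k) (v : V) : v \in span_pred -> a *: v \in span_pred.
Proof.
move/span_predP=> hv; apply/span_predP; rewrite -[_ *: _]addr0.
by apply: in_span_submodule.2 => //; apply: in_span_submodule.1.
Qed.

Lemma span_pred_zmod_closed : zmod_closed span_pred.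
Proof.
split=> [|u v hu hv]; first by apply/span_predP; exact: in_span_submodule.1.
have /span_predP hNv := span_predZ (-1) hv; move/span_predP: hu => hu.
apply/span_predP; rewrite -[u]scale1r -scaleN1r.
exact: in_span_submodule.2 1 u _ hu hNv.
Qed.

HB.instance Definition _ :=
  GRing.isZmodClosed.Build V span_pred span_pred_zmod_closed.

Definition qmod : Type := {quot span_pred}.
HB.instance Definition _ := GRing.Zmodule.on qmod.

Definition qproj (v : V) : qmod := \pi_({quot span_pred}) v.

Lemma qproj_surj (x : qmod) : exists v, x = qproj v.
Proof. by exists (repr x); rewrite /qproj reprK. Qed.

Lemma qprojE (u v : V) : (qproj u = qproj v) <-> in_span (u - v).
Proof.
rewrite /qproj; split=> [/eqP|/span_predP].
  by rewrite -idealrBE => /span_predP.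
by rewrite idealrBE => /eqP.
Qed.

Lemma qprojD (u v : V) : qproj (u + v) = qproj u + qproj v.
Proof. exact: raddfD. Qed.

Definition qscale (a : k) (x : qmod) : qmod := qproj (a *: repr x).

Lemma qscale_proj (a : k) (v : V) : qscale a (qproj v) = qproj (a *: v).
Proof.
apply/qprojE; rewrite -scalerBr; apply/span_predP/span_predZ.
by rewrite idealrBE reprK.
Qed.

Fact qscaleA a b x : qscale a (qscale b x) = qscale (a * b) x.
Proof. by have [v ->] := qproj_surj x; rewrite !qscale_proj scalerA. Qed.
Fact qscale1 : left_id 1 qscale.
Proof. by move=> x; have [v ->] := qproj_surj x; rewrite qscale_proj scale1r. Qed.
Fact qscaleDr : right_distributive qscale +%R.
Proof.
move=> a x y; have [u ->] := qproj_surj x; have [v ->] := qproj_surj y.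
by rewrite -qprojD !qscale_proj scalerDr qprojD.
Qed.
Fact qscaleDl x : {morph qscale^~ x : a b / a + b}.
Proof.
by move=> a b; have [v ->] := qproj_surj x; rewrite !qscale_proj scalerDl qprojD.
Qed.

HB.instance Definition _ := GRing.Zmodule_isLmodule.Build k qmod
  qscaleA qscale1 qscaleDr qscaleDl.

Fact qproj_linear : linear qproj.
Proof. by move=> a u v; rewrite qprojD -qscale_proj. Qed.
HB.instance Definition _ := GRing.isLinear.Build k V qmod _ qproj qproj_linear.

Section Lift.
Variables (W : lmodType k) (f : {linear V -> W}).
Hypothesis f0 : forall g, G g -> f g = 0.

Definition qlift_fun (x : qmod) : W := f (repr x).

Lemma qlift_proj (v : V) : qlift_fun (qproj v) = f v.
Proof.
apply/eqP; rewrite /qlift_fun -subr_eq0 -raddfB; apply/eqP.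
have hv : in_span (repr (qproj v) - v) by apply/qprojE; rewrite /qproj reprK.
apply: (hv (fun w => f w = 0)) => //; split=> [|a u w hu hw].
  exact: raddf0.
by rewrite linearP hu hw scaler0 addr0.
Qed.

Fact qlift_linear : linear qlift_fun.
Proof.
move=> a x y; have [u ->] := qproj_surj x; have [v ->] := qproj_surj y.
by rewrite -linearP !qlift_proj linearP.
Qed.

Definition qlift : {linear qmod -> W} := linmap qlift_linear.
End Lift.
End QuotientModule.

Section Tensor.
Variables (k : fieldType) (U V : lmodType k).

Variant bilinear_relation : {freeg (U * V)%type / k} -> Prop :=
| BilinearL (a : k) (u u' : U) (v : V) :
    bilinear_relation (<<(a *: u + u', v)>> - (a *: <<(u, v)>> + <<(u', v)>>))
| BilinearR (a : k) (u : U) (v v' : V) :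
    bilinear_relation (<<(u, a *: v + v')>> - (a *: <<(u, v)>> + <<(u, v')>>)).

Definition tensor : lmodType k := qmod bilinear_relation.

Definition tens (u : U) (v : V) : tensor := qproj bilinear_relation <<(u, v)>>.

Lemma tensPl a u u' v : tens (a *: u + u') v = a *: tens u v + tens u' v.
Proof.
rewrite /tens -linearP; apply/qprojE => S _; apply; exact: BilinearL.
Qed.

Lemma tensPr a u v v' : tens u (a *: v + v') = a *: tens u v + tens u v'.
Proof.
rewrite /tens -linearP; apply/qprojE => S _; apply; exact: BilinearR.
Qed.

Lemma tens_hom_ext (W : lmodType k) (f g : {linear tensor -> W}) :
  (forall u v, f (tens u v) = g (tens u v)) -> f =1 g.
Proof.
move=> fg x; have [y ->] := qproj_surj x.
rewrite -(freeg_sumE y) !linear_sum; apply: eq_bigr => -[u v] _ /=.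
have -> : << coeff (u, v) y *g (u, v) >> =
    coeff (u, v) y *: << (u, v) >> :> {freeg (U * V)%type / k}.
  by apply/eqP/freeg_eqP => z; rewrite coeffZ !coeffU mul1r.
by rewrite !linearZ /= fg.
Qed.

Section Lift.
Variables (W : lmodType k) (f : U -> V -> W).
Hypothesis fl : forall v, linear (f^~ v).
Hypothesis fr : forall u, linear (f u).

Let F (p : U * V) : W := f p.1 p.2.

Fact fglift_linear : linear (fglift F).
Proof.
have FD (x y : {freeg (U * V)%type / k}) :
    fglift F (x + y) = fglift F x + fglift F y.
  have FB := lift_is_additive F.
  have F0 : fglift F 0 = 0 by rewrite -(subrr 0) FB subrr.
  have FN z : fglift F (- z) = - fglift F z by rewrite -sub0r FB F0 sub0r.
  by rewrite -{1}[y]opprK FB FN opprK.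
have F0 : fglift F 0 = 0 by apply: (addrI (fglift F 0)); rewrite -FD !addr0.
have Fsum (s : seq (U * V)) (c : U * V -> k) :
    fglift F (\sum_(z <- s) << c z *g z >>) = \sum_(z <- s) c z *: F z.
  elim: s => [|z s IHs]; first by rewrite !big_nil.
  by rewrite !big_cons FD IHs liftU.
move=> a x y; rewrite FD; congr (_ + _).
have -> : fglift F x = \sum_(z <- dom x) coeff z x *: F z.
  by rewrite -(Fsum _ (fun z => coeff z x)) freeg_sumE.
rewrite scaler_sumr [a *: x]/(fgscale a x) /fgscale.
rewrite (Fsum _ (fun z => a * coeff z x)).
by apply: eq_bigr => z _; rewrite scalerA.
Qed.

Fact tlift_subproof g : bilinear_relation g -> linmap fglift_linear g = 0.
Proof.
by case=> [a u u' v|a u v v']; rewrite linearB linearP /= !liftU !scale1r /F /=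
  ?fl ?fr subrr.
Qed.

Lemma tlift_ex : {g : {linear tensor -> W} | forall u v, g (tens u v) = f u v}.
Proof.
exists (qlift tlift_subproof) => u v; rewrite /tens.
by apply: (etrans (qlift_proj tlift_subproof _)); rewrite /= liftU scale1r.
Qed.

Definition tlift : {linear tensor -> W} := sval tlift_ex.

Lemma tliftE u v : tlift (tens u v) = f u v.
Proof. exact: (svalP tlift_ex). Qed.
End Lift.
End Tensor.

Fact tmap_l (k : fieldType) (U V U' V' : lmodType k)
  (f : {linear U -> U'}) (g : {linear V -> V'}) (v : V) :
  linear (fun u => tens (f u) (g v)).
Proof. by move=> a u u'; rewrite linearP tensPl. Qed.
Fact tmap_r (k : fieldType) (U V U' V' : lmodType k)
  (f : {linear U -> U'}) (g : {linear V -> V'}) (u : U) :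
  linear (fun v => tens (f u) (g v)).
Proof. by move=> a v v'; rewrite linearP tensPr. Qed.

Section TensorFunctor.
Variables (k : fieldType).

Definition tmap (U V U' V' : lmodType k)
    (f : {linear U -> U'}) (g : {linear V -> V'}) :
  {linear tensor U V -> tensor U' V'} := tlift (tmap_l f g) (tmap_r f g).

Lemma tmapE (U V U' V' : lmodType k)
    (f : {linear U -> U'}) (g : {linear V -> V'}) u v :
  tmap f g (tens u v) = tens (f u) (g v).
Proof. exact: tliftE. Qed.

Section Assoc.
Variables (U V W : lmodType k).

Fact tassoc_in_l (w : W) (v : V) :
  linear (fun u : U => tens u (tens v w)).
Proof. by move=> a u u'; rewrite tensPl. Qed.
Fact tassoc_in_r (w : W) (u : U) :
  linear (fun v : V => tens u (tens v w)).
Proof. by move=> a v v'; rewrite tensPl tensPr. Qed.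
Definition tassoc_in (w : W) : {linear tensor U V -> tensor U (tensor V W)} :=
  tlift (tassoc_in_l w) (tassoc_in_r w).
Lemma tassoc_inE w u v : tassoc_in w (tens u v) = tens u (tens v w).
Proof. exact: tliftE. Qed.
Fact tassoc_r (x : tensor U V) : linear (fun w => tassoc_in w x).
Proof.
move=> a w w'.
pose g : {linear tensor U V -> tensor U (tensor V W)} :=
  a \*: tassoc_in w \+ tassoc_in w'.
apply: (tens_hom_ext (g := g)) => u v.
by rewrite /g /= !tassoc_inE !tensPr.
Qed.
Definition tassoc : {linear tensor (tensor U V) W -> tensor U (tensor V W)} :=
  tlift (fun w => linearP (tassoc_in w)) tassoc_r.
Lemma tassocE u v w : tassoc (tens (tens u v) w) = tens u (tens v w).
Proof. by rewrite /tassoc tliftE; exact: tassoc_inE. Qed.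

Fact tassocV_in_l (u : U) (w : W) :
  linear (fun v : V => tens (tens u v) w).
Proof. by move=> a v v'; rewrite tensPr tensPl. Qed.
Fact tassocV_in_r (u : U) (v : V) :
  linear (fun w : W => tens (tens u v) w).
Proof. by move=> a w w'; rewrite tensPr. Qed.
Definition tassocV_in (u : U) : {linear tensor V W -> tensor (tensor U V) W} :=
  tlift (tassocV_in_l u) (tassocV_in_r u).
Lemma tassocV_inE u v w : tassocV_in u (tens v w) = tens (tens u v) w.
Proof. exact: tliftE. Qed.
Fact tassocV_l (x : tensor V W) : linear (fun u => tassocV_in u x).
Proof.
move=> a u u'.
pose g : {linear tensor V W -> tensor (tensor U V) W} :=
  a \*: tassocV_in u \+ tassocV_in u'.
apply: (tens_hom_ext (g := g)) => v w.
by rewrite /g /= !tassocV_inE !tensPl.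
Qed.
Definition tassocV : {linear tensor U (tensor V W) -> tensor (tensor U V) W} :=
  tlift tassocV_l (fun u => linearP (tassocV_in u)).
Lemma tassocVE u v w : tassocV (tens u (tens v w)) = tens (tens u v) w.
Proof. by rewrite /tassocV tliftE; exact: tassocV_inE. Qed.
End Assoc.
End TensorFunctor.

(* A word [:: V1; ...; Vn] stands for the tensor product of its letters,
   bracketed to the right (and for k when it is empty). The tensor product of
   maps concatenates words, so that on explicit words the associativity and unit
   constraints of the tensor product are conversions and never have to be
   written (the cast of tjoinA disappears there): for instance, if c maps V ⊗ W
   to W ⊗ V, then c ⊗ Id X has type Hom ⟨V; W; X⟩ ⟨W; V; X⟩. *)
Section Words.
Variable k : fieldType.
Local Notation word := (seq (lmodType k)).

Fixpoint Tens (w : word) : lmodType k :=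
  match w with
  | [::] => k^o
  | V :: w' => match w' with [::] => V | _ :: _ => tensor V (Tens w') end
  end.

Definition Hom (w w' : word) := {linear Tens w -> Tens w'}.

Lemma hom_ext (w w' : word) (f g : Hom w w') : f =1 g -> f = g.
Proof.
move/funext; case: f => f [[f1] [f2]]; case: g => g [[g1] [g2]] /= efg.
by subst g; rewrite (Prop_irrelevance f1 g1) (Prop_irrelevance f2 g2).
Qed.

Definition hid (w : word) : Hom w w := idfun.
Definition Id (V : lmodType k) : Hom [:: V] [:: V] := hid [:: V].
Definition hcomp (u v w : word) (g : Hom v w) (f : Hom u v) : Hom u w := g \o f.

Fact scale_tens_l (V : lmodType k) (v : V) : linear (fun a : k^o => a *: v).
Proof. by move=> a b c; rewrite scalerDl scalerA. Qed.
Fact scale_tens_r (V : lmodType k) (a : k^o) : linear (fun v : V => a *: v).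
Proof. by move=> b u v; rewrite scalerDr !scalerA mulrC. Qed.

Definition lunit (V : lmodType k) : {linear tensor k^o V -> V} :=
  tlift (@scale_tens_l V) (@scale_tens_r V).
Fact lunitV_linear (V : lmodType k) : linear (fun v : V => tens (1 : k^o) v).
Proof. by move=> a u v; rewrite tensPr. Qed.
Definition lunitV (V : lmodType k) : {linear V -> tensor k^o V} :=
  linmap (@lunitV_linear V).

Definition runit (V : lmodType k) : {linear tensor V k^o -> V} :=
  tlift (fun a => @scale_tens_r V a) (fun v => @scale_tens_l V v).
Fact runitV_linear (V : lmodType k) : linear (fun v : V => tens v (1 : k^o)).
Proof. by move=> a u v; rewrite tensPl. Qed.
Definition runitV (V : lmodType k) : {linear V -> tensor V k^o} :=
  linmap (@runitV_linear V).

Definition lid (V : lmodType k) : {linear V -> V} := idfun.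

Definition tcons (V : lmodType k) (w : word) : {linear tensor V (Tens w) -> Tens (V :: w)} :=
  match w with
  | [::] => runit V
  | _ :: _ => idfun
  end.
Definition tuncons (V : lmodType k) (w : word) : {linear Tens (V :: w) -> tensor V (Tens w)} :=
  match w with
  | [::] => runitV V
  | _ :: _ => idfun
  end.

Fixpoint tjoin (w w' : word) : {linear tensor (Tens w) (Tens w') -> Tens (w ++ w')} :=
  match w with
  | [::] => lunit (Tens w')
  | V :: u => tcons V (u ++ w') \o tmap (lid V) (tjoin u w') \o
              tassoc _ _ _ \o tmap (tuncons V u) (lid (Tens w'))
  end.

Fixpoint tsplit (w w' : word) : {linear Tens (w ++ w') -> tensor (Tens w) (Tens w')} :=
  match w with
  | [::] => lunitV (Tens w')
  | V :: u => tmap (tcons V u) (lid (Tens w')) \o (tassocV _ _ _ \o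
              (tmap (lid V) (tsplit u w') \o tuncons V (u ++ w')))
  end.

Definition htens (u u' v v' : word) (f : Hom u u') (g : Hom v v') :
  Hom (u ++ v) (u' ++ v') := tjoin u' v' \o tmap f g \o tsplit u v.
End Words.

Notation "⟨ U ; .. ; V ⟩" :=
  (@cons (lmodType _) U .. (@cons (lmodType _) V (@nil (lmodType _))) ..)
  (at level 0, U at level 99, V at level 99, format "⟨ U ;  .. ;  V ⟩").
Notation "g ∘ f" := (hcomp g f) (at level 40, left associativity).
Notation "f ⊗ g" := (htens f g) (at level 38, left associativity).

Section TensorOfMaps.
Variable k : fieldType.
Local Notation word := (seq (lmodType k)).

Lemma tmap_comp (U V U' V' U'' V'' : lmodType k)
    (f : {linear U -> U'}) (g : {linear V -> V'})
    (f' : {linear U' -> U''}) (g' : {linear V' -> V''}) :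
  tmap (f' \o f) (g' \o g) =1 tmap f' g' \o tmap f g.
Proof. by apply: tens_hom_ext => u v; rewrite /= !tmapE. Qed.

Lemma tmap_eq_id (U V : lmodType k) (f : {linear U -> U}) (g : {linear V -> V}) :
  f =1 id -> g =1 id -> tmap f g =1 id.
Proof.
move=> f1 g1; apply: (tens_hom_ext (g := idfun)) => u v.
by rewrite tmapE f1 g1.
Qed.

Lemma tmapK (U V U' V' : lmodType k)
    (f : {linear U -> U'}) (g : {linear V -> V'})
    (f' : {linear U' -> U}) (g' : {linear V' -> V}) :
  cancel f f' -> cancel g g' -> cancel (tmap f g) (tmap f' g').
Proof.
move=> fK gK x; rewrite -[LHS]/((tmap f' g' \o tmap f g) x) -tmap_comp.
exact: tmap_eq_id.
Qed.

Lemma tassocK (U V W : lmodType k) : cancel (@tassoc k U V W) (@tassocV k U V W).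
Proof.
apply: (tens_hom_ext (f := tassocV U V W \o tassoc U V W) (g := idfun)) => x w.
pose h : {linear tensor U V -> _} := linmap (fun a u u' => tensPl a u u' w).
apply: (tens_hom_ext (f := tassocV U V W \o tassoc U V W \o h) (g := h)) => u v.
by rewrite /= tassocE tassocVE.
Qed.

Lemma tassocVK (U V W : lmodType k) : cancel (@tassocV k U V W) (@tassoc k U V W).
Proof.
apply: (tens_hom_ext (f := tassoc U V W \o tassocV U V W) (g := idfun)) => u x.
pose h : {linear tensor V W -> _} := linmap (fun a w w' => tensPr a u w w').
apply: (tens_hom_ext (f := tassoc U V W \o tassocV U V W \o h) (g := h)) => v w.
by rewrite /= tassocVE tassocE.
Qed.

Lemma lunitE (V : lmodType k) (a : k^o) (v : V) : lunit V (tens a v) = a *: v.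
Proof. exact: tliftE. Qed.
Lemma runitE (V : lmodType k) (a : k^o) (v : V) : runit V (tens v a) = a *: v.
Proof. exact: tliftE. Qed.

Lemma tensZ (U V : lmodType k) (a : k) (u : U) (v : V) :
  tens (a *: u) v = tens u (a *: v).
Proof.
pose fl : {linear U -> _} := linmap (fun b x y => tensPl b x y v).
pose fr : {linear V -> _} := linmap (fun b x y => tensPr b u x y).
by rewrite -[LHS]/(fl _) -[RHS]/(fr _) !linearZ.
Qed.

Lemma lunitK (V : lmodType k) : cancel (lunit V) (lunitV V).
Proof.
apply: (tens_hom_ext (f := lunitV V \o lunit V) (g := idfun)) => a v /=.
by rewrite lunitE -tensZ [_ *: _]mulr1.
Qed.
Lemma lunitVK (V : lmodType k) : cancel (lunitV V) (lunit V).
Proof. by move=> v; rewrite /= lunitE scale1r. Qed.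
Lemma runitK (V : lmodType k) : cancel (runit V) (runitV V).
Proof.
apply: (tens_hom_ext (f := runitV V \o runit V) (g := idfun)) => v a /=.
by rewrite runitE tensZ [_ *: _]mulr1.
Qed.
Lemma runitVK (V : lmodType k) : cancel (runitV V) (runit V).
Proof. by move=> v; rewrite /= runitE scale1r. Qed.

Lemma tconsK (V : lmodType k) w : cancel (tcons V w) (tuncons V w).
Proof. by case: w => [|? ?] // x; apply: runitK. Qed.
Lemma tunconsK (V : lmodType k) w : cancel (tuncons V w) (tcons V w).
Proof. by case: w => [|? ?] // x; apply: runitVK. Qed.

Lemma lidK (V : lmodType k) : cancel (lid V) (lid V).
Proof. by []. Qed.

Lemma tjoinK (w w' : word) : cancel (tjoin w w') (tsplit w w').
Proof.
elim: w => [|V w IHw]; first exact: lunitK.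
have h1 : cancel (tmap (lid V) (tjoin w w')) (tmap (lid V) (tsplit w w')).
  exact: (tmapK (@lidK V) IHw).
have h2 : cancel (tmap (tuncons V w) (lid (Tens w'))) (tmap (tcons V w) (lid (Tens w'))).
  exact: (tmapK (@tunconsK V w) (@lidK _)).
exact: can_comp (can_comp (can_comp (@tconsK V (w ++ w')) h1) (@tassocK _ _ _)) h2.
Qed.
Lemma tsplitK (w w' : word) : cancel (tsplit w w') (tjoin w w').
Proof.
elim: w => [|V w IHw]; first exact: lunitVK.
have h1 : cancel (tmap (lid V) (tsplit w w')) (tmap (lid V) (tjoin w w')).
  exact: (tmapK (@lidK V) IHw).
have h2 : cancel (tmap (tcons V w) (lid (Tens w'))) (tmap (tuncons V w) (lid (Tens w'))).
  exact: (tmapK (@tconsK V w) (@lidK _)).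
exact: can_comp h2 (can_comp (@tassocVK _ _ _) (can_comp h1 (@tunconsK V (w ++ w')))).
Qed.

Lemma htens_tjoin (u u' v v' : word) (f : Hom u u') (g : Hom v v') x y :
  (f ⊗ g) (tjoin u v (tens x y)) = tjoin u' v' (tens (f x) (g y)).
Proof. by rewrite /= tjoinK tmapE. Qed.

Lemma htens_comp (u u' u'' v v' v'' : word) (f : Hom u u') (g : Hom v v')
    (f' : Hom u' u'') (g' : Hom v' v'') :
  (f' ∘ f) ⊗ (g' ∘ g) = (f' ⊗ g') ∘ (f ⊗ g).
Proof. by apply: hom_ext => x; rewrite /= tjoinK tmap_comp. Qed.

Lemma htens_id (u v : word) : hid u ⊗ hid v = hid (u ++ v).
Proof. by apply: hom_ext => x; rewrite /= tmap_eq_id //= tsplitK. Qed.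

Definition hcast (u v : word) (e : u = v) : Hom u v :=
  match e in _ = v return Hom u v with erefl => hid u end.

Lemma tcons_cast (V : lmodType k) (w w' : word) (e : w = w') (v : V) x :
  tcons V w' (tens v (hcast e x)) = hcast (congr1 (cons V) e) (tcons V w (tens v x)).
Proof. by case: w' / e. Qed.

Lemma tensZl (U V : lmodType k) (a : k) (u : U) (v : V) :
  tens (a *: u) v = a *: tens u v.
Proof.
pose fl : {linear U -> tensor U V} := linmap (fun b x y => tensPl b x y v).
by rewrite -[LHS]/(fl _) linearZ.
Qed.

Lemma tjoin_cons (V : lmodType k) (u w : word) v x y :
  tjoin (V :: u) w (tens (tcons V u (tens v x)) y) =
  tcons V (u ++ w) (tens v (tjoin u w (tens x y))).
Proof.
rewrite -[LHS]/(tcons V (u ++ w) (tmap (lid V) (tjoin u w) (tassoc _ _ _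
  (tmap (tuncons V u) (lid _) (tens (tcons V u (tens v x)) y))))).
by rewrite tmapE tconsK tassocE tmapE.
Qed.

Lemma tjoinA (u v w : word) x y z :
  hcast (esym (catA u v w)) (tjoin (u ++ v) w (tens (tjoin u v (tens x y)) z)) =
  tjoin u (v ++ w) (tens x (tjoin v w (tens y z))).
Proof.
elim: u x => [|V u IH] x.
  rewrite [esym _](Prop_irrelevance _ erefl) /= !lunitE.
  by rewrite tensZl linearZ.
rewrite -[x](@tunconsK V u); move: (tuncons V u x) => {}x.
pose cl (y : Tens v) : {linear Tens (V :: u) -> _} := linmap (fun a s t => tensPl a s t y).
pose cz : {linear Tens ((V :: u) ++ v) -> _} := linmap (fun a s t => tensPl a s t z).
pose cl2 (y : Tens (v ++ w)) : {linear Tens (V :: u) -> _} :=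
  linmap (fun a s t => tensPl a s t y).
pose F : {linear tensor V (Tens u) -> _} :=
  hcast (esym (catA (V :: u) v w)) \o (tjoin ((V::u) ++ v) w \o
    (cz \o (tjoin (V :: u) v \o (cl y \o tcons V u)))).
pose G : {linear tensor V (Tens u) -> _} :=
  tjoin (V :: u) (v ++ w) \o (cl2 (tjoin v w (tens y z)) \o tcons V u).
rewrite -[LHS]/(F x) -[RHS]/(G x); apply: tens_hom_ext => {x} a b.
rewrite -[LHS]/(hcast (esym (catA (V :: u) v w))
  (tjoin ((V::u) ++ v) w (tens (tjoin (V :: u) v (tens (tcons V u (tens a b)) y)) z))).
rewrite -[RHS]/(tjoin (V :: u) (v ++ w) (tens (tcons V u (tens a b))
  (tjoin v w (tens y z)))).
rewrite !tjoin_cons -IH tcons_cast.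
by congr (hcast _ _); apply: Prop_irrelevance.
Qed.

Lemma tjoin11 (U V : lmodType k) u v : tjoin [:: U] [:: V] (tens u v) = tens u v.
Proof. by rewrite /= !(tmapE, tassocE, lunitE) scale1r. Qed.

Lemma htensE (U U' V V' : lmodType k)
    (f : Hom [:: U] [:: U']) (g : Hom [:: V] [:: V']) u v :
  (f ⊗ g) (tens u v) = tens (f u) (g v).
Proof. by rewrite -[in LHS]tjoin11 htens_tjoin tjoin11. Qed.
End TensorOfMaps.

Section Compatibility.
Variables (k : fieldType) (V W : lmodType k) (c : Hom ⟨V; W⟩ ⟨W; V⟩).

Definition compat_alg_l (mu : Hom ⟨V; V⟩ ⟨V⟩) (eta : Hom [::] ⟨V⟩) : Prop :=
  c ∘ (eta ⊗ Id W) = Id W ⊗ eta /\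
  c ∘ (mu ⊗ Id W) = (Id W ⊗ mu) ∘ (c ⊗ Id V) ∘ (Id V ⊗ c).

Definition compat_alg_r (mu : Hom ⟨W; W⟩ ⟨W⟩) (eta : Hom [::] ⟨W⟩) : Prop :=
  c ∘ (Id V ⊗ eta) = eta ⊗ Id V /\
  c ∘ (Id V ⊗ mu) = (mu ⊗ Id V) ∘ (Id W ⊗ c) ∘ (c ⊗ Id W).

Definition compat_coalg_l (Delta : Hom ⟨V⟩ ⟨V; V⟩) (eps : Hom ⟨V⟩ [::]) : Prop :=
  (Id W ⊗ eps) ∘ c = eps ⊗ Id W /\
  (Id W ⊗ Delta) ∘ c = (c ⊗ Id V) ∘ (Id V ⊗ c) ∘ (Delta ⊗ Id W).

Definition compat_coalg_r (Delta : Hom ⟨W⟩ ⟨W; W⟩) (eps : Hom ⟨W⟩ [::]) : Prop :=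
  (eps ⊗ Id V) ∘ c = Id V ⊗ eps /\
  (Delta ⊗ Id V) ∘ c = (Id W ⊗ c) ∘ (c ⊗ Id W) ∘ (Id V ⊗ Delta).
End Compatibility.

Definition is_algebra (k : fieldType) (V : lmodType k)
    (mu : Hom ⟨V; V⟩ ⟨V⟩) (eta : Hom [::] ⟨V⟩) : Prop :=
  [/\ mu ∘ (mu ⊗ Id V) = mu ∘ (Id V ⊗ mu),
      mu ∘ (eta ⊗ Id V) = Id V
    & mu ∘ (Id V ⊗ eta) = Id V].

Definition is_coalgebra (k : fieldType) (V : lmodType k)
    (Delta : Hom ⟨V⟩ ⟨V; V⟩) (eps : Hom ⟨V⟩ [::]) : Prop :=
  [/\ (Delta ⊗ Id V) ∘ Delta = (Id V ⊗ Delta) ∘ Delta,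
      (eps ⊗ Id V) ∘ Delta = Id V
    & (Id V ⊗ eps) ∘ Delta = Id V].

(* Unlike algType, this includes the zero algebra. *)
Record algebra (k : fieldType) := Algebra {
  alg_space :> lmodType k;
  mu : Hom ⟨alg_space; alg_space⟩ ⟨alg_space⟩;
  eta : Hom [::] ⟨alg_space⟩;
  algebraP : is_algebra mu eta
}.

Definition alg_one (k : fieldType) (A : algebra k) : A := eta A (1 : k^o).

Definition algebra_morphism (k : fieldType) (A B : algebra k)
    (f : Hom ⟨A⟩ ⟨B⟩) : Prop :=
  f ∘ mu A = mu B ∘ (f ⊗ f) /\ f ∘ eta A = eta B.

Definition braid_equation (k : fieldType) (V : lmodType k)
    (c : Hom ⟨V; V⟩ ⟨V; V⟩) : Prop :=
  (c ⊗ Id V) ∘ (Id V ⊗ c) ∘ (c ⊗ Id V) = (Id V ⊗ c) ∘ (c ⊗ Id V) ∘ (Id V ⊗ c).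

Record braided_bialgebra (k : fieldType) := BraidedBialgebra {
  bialg_algebra :> algebra k;
  Delta : Hom ⟨bialg_algebra⟩ ⟨bialg_algebra; bialg_algebra⟩;
  eps : Hom ⟨bialg_algebra⟩ [::];
  braid : Hom ⟨bialg_algebra; bialg_algebra⟩ ⟨bialg_algebra; bialg_algebra⟩;
  coalgebraP : is_coalgebra Delta eps;
  braid_bij : bijective braid;
  braidP : braid_equation braid;
  braid_algP : compat_alg_l braid (mu bialg_algebra) (eta bialg_algebra) /\
               compat_alg_r braid (mu bialg_algebra) (eta bialg_algebra);
  braid_coalgP : compat_coalg_l braid Delta eps /\ compat_coalg_r braid Delta eps;
  eta_coalgP : Delta ∘ eta bialg_algebra = eta bialg_algebra ⊗ eta bialg_algebra /\
               eps ∘ eta bialg_algebra = hid [::];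
  eps_algP : eps ∘ mu bialg_algebra = eps ⊗ eps;
  Delta_muP : Delta ∘ mu bialg_algebra =
    (mu bialg_algebra ⊗ mu bialg_algebra) ∘
    (Id bialg_algebra ⊗ braid ⊗ Id bialg_algebra) ∘ (Delta ⊗ Delta)
}.

Section Convolution.
Variables (k : fieldType) (C : seq (lmodType k)) (A : algebra k).
Variables (D : Hom C (C ++ C)) (e : Hom C [::]).

Definition convol (f g : Hom C ⟨A⟩) : Hom C ⟨A⟩ := mu A ∘ (f ⊗ g) ∘ D.

Definition conv_inverse (f g : Hom C ⟨A⟩) : Prop :=
  convol f g = eta A ∘ e /\ convol g f = eta A ∘ e.

Definition conv_invertible (f : Hom C ⟨A⟩) : Prop := exists g, conv_inverse f g.
End Convolution.

Record braided_Hopf (k : fieldType) := BraidedHopf {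
  Hopf_bialgebra :> braided_bialgebra k;
  antipodeP : conv_invertible (Delta Hopf_bialgebra) (eps Hopf_bialgebra)
                (Id Hopf_bialgebra)
}.

Definition left_H_space (k : fieldType) (H : braided_bialgebra k) (V : lmodType k)
    (s : Hom ⟨H; V⟩ ⟨V; H⟩) : Prop :=
  [/\ bijective s,
      compat_alg_l s (mu H) (eta H),
      compat_coalg_l s (Delta H) (eps H)
    & (s ⊗ Id H) ∘ (Id H ⊗ s) ∘ (braid H ⊗ Id V) =
      (Id V ⊗ braid H) ∘ (s ⊗ Id H) ∘ (Id H ⊗ s)].

Definition left_transposition (k : fieldType) (H : braided_bialgebra k)
    (A : algebra k) (s : Hom ⟨H; A⟩ ⟨A; H⟩) : Prop :=
  left_H_space s /\ compat_alg_r s (mu A) (eta A).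

Record comodule_algebra (k : fieldType) (H : braided_bialgebra k) := ComoduleAlgebra {
  comod_algebra :> algebra k;
  coact : Hom ⟨comod_algebra⟩ ⟨comod_algebra; H⟩;
  transp : Hom ⟨H; comod_algebra⟩ ⟨comod_algebra; H⟩;
  coact_assoc : (coact ⊗ Id H) ∘ coact = (Id comod_algebra ⊗ Delta H) ∘ coact;
  coact_counit : (Id comod_algebra ⊗ eps H) ∘ coact = Id comod_algebra;
  transpP : left_transposition transp;
  coact_transp : (coact ⊗ Id H) ∘ transp =
    (Id comod_algebra ⊗ braid H) ∘ (transp ⊗ Id H) ∘ (Id H ⊗ coact);
  coact_mu : coact ∘ mu comod_algebra =
    (mu comod_algebra ⊗ mu H) ∘ (Id comod_algebra ⊗ transp ⊗ Id H) ∘ (coact ⊗ coact);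
  coact_one : coact (alg_one comod_algebra) = tens (alg_one comod_algebra) (alg_one H)
}.

(* The structure maps to which a morphism of comodule algebras refers. They are
   carried by a word, so as to apply to B as well as to A ⊗ H. *)
Record comodule_algebra_data (k : fieldType) (H : braided_bialgebra k) :=
  ComoduleAlgebraData {
    cad_word :> seq (lmodType k);
    cad_mu : Hom (cad_word ++ cad_word) cad_word;
    cad_eta : Hom [::] cad_word;
    cad_coact : Hom cad_word (cad_word ++ ⟨H⟩);
    cad_transp : Hom (⟨H⟩ ++ cad_word) (cad_word ++ ⟨H⟩)
  }.

Definition data_of (k : fieldType) (H : braided_bialgebra k)
    (B : comodule_algebra H) : comodule_algebra_data H :=
  @ComoduleAlgebraData k H ⟨B⟩ (mu B) (eta B) (coact B) (transp B).

Definition comodule_algebra_morphism (k : fieldType) (H : braided_bialgebra k)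
    (X Y : comodule_algebra_data H) (f : Hom X Y) : Prop :=
  [/\ f ∘ cad_mu X = cad_mu Y ∘ (f ⊗ f),
      f ∘ cad_eta X = cad_eta Y,
      cad_coact Y ∘ f = (f ⊗ Id H) ∘ cad_coact X
    & (f ⊗ Id H) ∘ cad_transp X = cad_transp Y ∘ (Id H ⊗ f)].

Definition comodule_algebra_isomorphism (k : fieldType) (H : braided_bialgebra k)
    (X Y : comodule_algebra_data H) (f : Hom X Y) : Prop :=
  comodule_algebra_morphism f /\ bijective f.

Section CrossedProduct.
Variables (k : fieldType) (H : braided_bialgebra k) (A : algebra k).
Variable sA : Hom ⟨H; A⟩ ⟨A; H⟩.

Definition Delta2 : Hom ⟨H; H⟩ ⟨H; H; H; H⟩ :=
  (Id H ⊗ braid H ⊗ Id H) ∘ (Delta H ⊗ Delta H).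

Definition Delta3 : Hom ⟨H; H; H⟩ ⟨H; H; H; H; H; H⟩ :=
  (Id H ⊗ Id H ⊗ braid H ⊗ Id H ⊗ Id H) ∘ (Id H ⊗ braid H ⊗ braid H ⊗ Id H) ∘
  (Delta H ⊗ Delta H ⊗ Delta H).

Definition hat_transp : Hom ⟨H; A; H⟩ ⟨A; H; H⟩ := (Id A ⊗ braid H) ∘ (sA ⊗ Id H).

Variables (rho : Hom ⟨H; A⟩ ⟨A⟩) (sigma : Hom ⟨H; H⟩ ⟨A⟩).

Definition weak_action : Prop :=
  [/\ rho ∘ (eta H ⊗ Id A) = Id A,
      rho ∘ (Id H ⊗ eta A) = eta A ∘ eps H,
      sA ∘ (Id H ⊗ rho) = (rho ⊗ Id H) ∘ (Id H ⊗ sA) ∘ (braid H ⊗ Id A)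
    & rho ∘ (Id H ⊗ mu A) =
      mu A ∘ (rho ⊗ rho) ∘ (Id H ⊗ sA ⊗ Id A) ∘ (Delta H ⊗ Id A ⊗ Id A)].

Definition normal_cocycle : Prop :=
  sigma ∘ (eta H ⊗ Id H) = eta A ∘ eps H /\ sigma ∘ (Id H ⊗ eta H) = eta A ∘ eps H.

Definition compatible_transp : Prop :=
  (sigma ⊗ Id H) ∘ (Id H ⊗ braid H) ∘ (braid H ⊗ Id H) = sA ∘ (Id H ⊗ sigma).

Definition cocycle : Prop :=
  mu A ∘ (rho ⊗ sigma) ∘ (Id H ⊗ sigma ⊗ Id H ⊗ mu H) ∘ Delta3 =
  mu A ∘ (Id A ⊗ sigma) ∘ (sigma ⊗ mu H ⊗ Id H) ∘ (Delta2 ⊗ Id H).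

Definition twisted_module : Prop :=
  mu A ∘ (rho ⊗ sigma) ∘ (Id H ⊗ rho ⊗ Id H ⊗ Id H) ∘
    (Id H ⊗ Id H ⊗ sA ⊗ Id H) ∘ (Id H ⊗ Id H ⊗ Id H ⊗ sA) ∘ (Delta2 ⊗ Id A) =
  mu A ∘ (Id A ⊗ rho) ∘ (sigma ⊗ mu H ⊗ Id A) ∘ (Delta2 ⊗ Id A).

Definition crossed_system : Prop :=
  [/\ weak_action, normal_cocycle, compatible_transp, cocycle & twisted_module].

Definition crossed_chi : Hom ⟨H; A⟩ ⟨A; H⟩ :=
  (rho ⊗ Id H) ∘ (Id H ⊗ sA) ∘ (Delta H ⊗ Id A).

Definition crossed_F : Hom ⟨H; H⟩ ⟨A; H⟩ := (sigma ⊗ mu H) ∘ Delta2.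

Definition crossed_mu : Hom ⟨A; H; A; H⟩ ⟨A; H⟩ :=
  (mu A ⊗ Id H) ∘ (mu A ⊗ crossed_F) ∘ (Id A ⊗ crossed_chi ⊗ Id H).

Definition crossed_product : comodule_algebra_data H :=
  @ComoduleAlgebraData k H ⟨A; H⟩ crossed_mu (eta A ⊗ eta H) (Id A ⊗ Delta H)
    hat_transp.

Definition cocycle_invertible : Prop :=
  conv_invertible (C := ⟨H; H⟩) Delta2 (eps H ⊗ eps H) sigma.
End CrossedProduct.

Section Extension.
Variables (k : fieldType) (H : braided_bialgebra k).
Variables (A : algebra k) (B : comodule_algebra H) (i : Hom ⟨A⟩ ⟨B⟩).

Definition coinvariant (b : B) : Prop := coact B b = tens b (alg_one H).

Definition H_extension : Prop :=
  [/\ algebra_morphism i, injective i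
    & forall b : B, coinvariant b <-> exists a : A, i a = b].

Definition induced_transp_spec (sA : Hom ⟨H; A⟩ ⟨A; H⟩) : Prop :=
  (i ⊗ Id H) ∘ sA = transp B ∘ (Id H ⊗ i).

(* For an H-extension exactly one map satisfies induced_transp_spec, since
   i ⊗ Id H is injective; the zero map is then irrelevant. *)
Definition induced_transp : Hom ⟨H; A⟩ ⟨A; H⟩ :=
  if pselect (exists sA, induced_transp_spec sA) is left ex then projT1 (cid ex)
  else \0.

Definition cleft_map (gamma : Hom ⟨H⟩ ⟨B⟩) : Prop :=
  [/\ conv_invertible (Delta H) (eps H) gamma,
      coact B ∘ gamma = (gamma ⊗ Id H) ∘ Delta H
    & (gamma ⊗ Id H) ∘ braid H = transp B ∘ (Id H ⊗ gamma)].

Definition cleft : Prop := exists gamma, cleft_map gamma.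

Variant balanced_relation : tensor B B -> Prop :=
| Balanced (b : B) (a : A) (b' : B) : balanced_relation
    (tens (mu B (tens b (i a))) b' - tens b (mu B (tens (i a) b'))).

Definition tensorA : lmodType k := qmod balanced_relation.

Definition tensA (b b' : B) : tensorA := qproj balanced_relation (tens b b').

(* beta is determined by its values on the b ⊗_A b'. The right-hand side is the
   product (b ⊗ 1)(coact b') of the algebra B ⊗ H, which is twisted by transp. *)
Definition Galois : Prop :=
  exists2 beta : {linear tensorA -> Tens ⟨B; H⟩},
    (forall b b', beta (tensA b b') =
      ((mu B ⊗ mu H) ∘ (Id B ⊗ transp B ⊗ Id H) ∘ (Id B ⊗ eta H ⊗ coact B))
        (tens b b'))
    & bijective beta.

Definition normal_basis (phi : Hom ⟨A; H⟩ ⟨B⟩) : Prop :=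
  [/\ bijective phi,
      phi ∘ (mu A ⊗ Id H) = mu B ∘ (i ⊗ phi),
      coact B ∘ phi = (phi ⊗ Id H) ∘ (Id A ⊗ Delta H)
    & (phi ⊗ Id H) ∘ hat_transp induced_transp = transp B ∘ (Id H ⊗ phi)].

Definition left_A_linear (f : Hom ⟨B⟩ ⟨A; H⟩) : Prop :=
  f ∘ mu B ∘ (i ⊗ Id B) = (mu A ⊗ Id H) ∘ (Id A ⊗ f).

End Extension.

(* Main.v *)
Require Import Defs.
From mathcomp Require Import all_boot ssralg boolp.

(** For a map f from a coalgebra C to an algebra X, let T_f(x ⊗ h) = x f(h₁) ⊗ h₂
    on X ⊗ C; then f is convolution invertible exactly when T_f is bijective.

    A left A-linear and right H-colinear isomorphism φ : A ⊗ H → B is determined by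
    γ = φ(1 ⊗ -). The map b ⊗ h ↦ b ⊗_A γ(h) is then an isomorphism from B ⊗ H to
    B ⊗_A B, and its composite with β is T_γ, so the extension is Galois if and only
    if γ is convolution invertible. If φ is moreover multiplicative on a crossed
    product, then T_γ (φ ⊗ H) = (φ ⊗ H) (A ⊗ T_id) T_σ, where T_id is bijective
    because H has an antipode: hence γ is invertible if and only if σ is.

    Conversely, let γ be a cleft map. Comparing two expressions of ν(b₀) ν(γ⁻¹(b₁))
    shows that b₀ γ⁻¹(b₁) is coinvariant, which gives a left A-linear map p : B → A,
    and φ(a ⊗ h) = i(a) γ(h) has the inverse (p ⊗ H) ν. The cocycle and twisted
    module conditions are p applied to the associativity of the products
    γ(h) γ(l) γ(m) and γ(h) γ(l) i(a). *)

Set Implicit Arguments.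
Unset Strict Implicit.
Unset Printing Implicit Defensive.

Import GRing.Theory.
Local Open Scope ring_scope.

(** * String diagrams *)

(* Packing maps with their source and target turns the associativity and unit laws
   of the tensor product, which hold only up to casts between words, into plain
   equations. *)
Section Arrows.
Variable k : fieldType.
Local Notation word := (seq (lmodType k)).

Record arr := Arr { src : word; tgt : word; fn : Hom src tgt }.

Definition idA (w : word) : arr := Arr (hid w).

(** Composition is partial, undefined when the words do not match, so that equations between
    composites carry no typing proofs. *)
Definition comp (g f : arr) : option arr :=
  if pselect (tgt f = src g) is left e
  then Some (Arr (fn g ∘ (hcast e ∘ fn f))) else None.

Definition tensor_arr (f g : arr) : arr := Arr (fn f ⊗ fn g).
Local Notation "f ⊠ g" := (tensor_arr f g) (at level 39, right associativity).

(** The claim is generalized to any packed map equal to [Arr g], with casts on both sides; proof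
    irrelevance for equalities of words then removes the casts. *)
Lemma Arr_inj u v : injective (@Arr u v).
Proof.
move=> f g fg.
have e (x : arr) : x = Arr g -> forall (eu : u = src x) (ev : tgt x = v),
    hcast ev ∘ fn x ∘ hcast eu = g.
  move=> -> /= eu ev; rewrite (Prop_irrelevance eu erefl).
  by rewrite (Prop_irrelevance ev erefl); apply: hom_ext.
by rewrite -(e _ fg erefl erefl); apply: hom_ext.
Qed.

Lemma Arr_eq u v u' v' (eu : u = u') (ev : v = v') (f : Hom u v) (f' : Hom u' v') :
  (forall x, hcast ev (f x) = f' (hcast eu x)) -> Arr f = Arr f'.
Proof.
by case: u' / eu f' => f'; case: v' / ev f' => f' ff'; congr Arr; apply: hom_ext.
Qed.

Lemma compE u v w (f : Hom u v) (g : Hom v w) :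
  comp (Arr g) (Arr f) = Some (Arr (g ∘ f)).
Proof.
rewrite /comp; case: pselect => //= e; rewrite (Prop_irrelevance e erefl).
by congr (Some (Arr _)); apply: hom_ext.
Qed.

Lemma comp_some f g r : comp g f = Some r ->
  [/\ tgt f = src g, src r = src f & tgt r = tgt g].
Proof. by rewrite /comp; case: pselect => //= e [<-]. Qed.

Lemma comp_none f g : tgt f <> src g -> comp g f = None.
Proof. by rewrite /comp; case: pselect. Qed.

Lemma compA f g h : obind (comp h) (comp g f) = obind (comp ^~ f) (comp h g).
Proof.
case: f g h => [u v f] [v' w g] [w' x h].
have [e|n] := pselect (v = v'); last first.
  rewrite (comp_none (f := Arr f) (g := Arr g)) //=.
  case E: (comp (Arr h) (Arr g)) => [r|] //=.
  by have [_ sr _] := comp_some E; rewrite comp_none // sr.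
case: v' / e g => g; rewrite compE /=.
have [e|n] := pselect (w = w'); last by rewrite !comp_none.
case: w' / e h => h; rewrite !compE /= compE; congr (Some (Arr _)); exact: hom_ext.
Qed.

Lemma comp_id_l f : comp (idA (tgt f)) f = Some f.
Proof. by case: f => u v f; rewrite compE; congr (Some (Arr _)); apply: hom_ext. Qed.
Lemma comp_id_r f : comp f (idA (src f)) = Some f.
Proof. by case: f => u v f; rewrite compE; congr (Some (Arr _)); apply: hom_ext. Qed.

Lemma comp_tens f f' g g' x y : comp f' f = Some x -> comp g' g = Some y ->
  comp (f' ⊠ g') (f ⊠ g) = Some (x ⊠ y).
Proof.
case: f f' g g' => [u v f] [v' w f'] [r s g] [s' t g'] Ex Ey.
have [/= e1 _ _] := comp_some Ex; have [/= e2 _ _] := comp_some Ey.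
case: v' / e1 f' Ex => f'; rewrite compE => -[<-].
case: s' / e2 g' Ey => g'; rewrite compE => -[<-].
by rewrite {1 2}/tensor_arr compE -htens_comp.
Qed.

Lemma tens_idA u v : idA u ⊠ idA v = idA (u ++ v).
Proof. by rewrite /tensor_arr /= htens_id. Qed.

Lemma tjoin3_ext (u v w : word) (V : lmodType k) (f g : {linear Tens ((u ++ v) ++ w) -> V}) :
  (forall x y z, f (tjoin _ _ (tens (tjoin u v (tens x y)) z)) =
                 g (tjoin _ _ (tens (tjoin u v (tens x y)) z))) -> f =1 g.
Proof.
move=> fg t; rewrite -[t]tsplitK; move: (tsplit _ _ t) => {}t.
apply: (tens_hom_ext (f := f \o tjoin _ _) (g := g \o tjoin _ _)) => a z.
pose cz : {linear Tens (u ++ v) -> _} := linmap (fun c s t => tensPl c s t z).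
rewrite -[a]tsplitK; move: (tsplit _ _ a) => {}a.
apply: (tens_hom_ext (f := f \o (tjoin _ w \o (cz \o tjoin _ _)))
  (g := g \o (tjoin _ w \o (cz \o tjoin _ _)))) => x y.
exact: fg.
Qed.

(** Up to casts, both sides agree on pure tensors by [tjoinA], and these span. *)
Lemma tensor_arrA f g h : (f ⊠ g) ⊠ h = f ⊠ (g ⊠ h).
Proof.
case: f g h => [u u' f] [v v' g] [w w' h].
apply: (Arr_eq (eu := esym (catA u v w)) (ev := esym (catA u' v' w'))) => x.
pose L : {linear Tens ((u ++ v) ++ w) -> _} :=
  hcast (esym (catA u' v' w')) \o ((f ⊗ g) ⊗ h).
pose R : {linear Tens ((u ++ v) ++ w) -> _} :=
  (f ⊗ (g ⊗ h)) \o hcast (esym (catA u v w)).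
rewrite -[LHS]/(L x) -[RHS]/(R x); apply: tjoin3_ext => {x} x y z.
rewrite -[LHS]/(hcast (esym (catA u' v' w')) (((f ⊗ g) ⊗ h)
  (tjoin (u ++ v) w (tens (tjoin u v (tens x y)) z)))).
rewrite -[RHS]/((f ⊗ (g ⊗ h)) (hcast (esym (catA u v w))
  (tjoin (u ++ v) w (tens (tjoin u v (tens x y)) z)))).
by rewrite !htens_tjoin !tjoinA !htens_tjoin.
Qed.

Lemma tens_id0l f : idA [::] ⊠ f = f.
Proof.
case: f => u v f; apply: (Arr_eq (eu := erefl) (ev := erefl)) => x /=.
by rewrite tmapE lunitE scale1r.
Qed.

Lemma tjoin_nil_r (u : word) x (a : k^o) :
  hcast (cats0 u) (tjoin u [::] (tens x a)) = a *: x.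
Proof.
elim: u x => [|V u IH] x.
  by rewrite (Prop_irrelevance (cats0 _) erefl) /= lunitE [LHS]mulrC.
rewrite -[x](@tunconsK _ V u); move: (tuncons V u x) => {}x.
pose cl : {linear Tens (V :: u) -> _} := linmap (fun c s t => tensPl c s t a).
pose F : {linear tensor V (Tens u) -> _} :=
  hcast (cats0 (V :: u)) \o (tjoin (V :: u) [::] \o (cl \o tcons V u)).
pose G : {linear tensor V (Tens u) -> _} := a \*: tcons V u.
rewrite -[LHS]/(F x) -[RHS]/(G x); apply: tens_hom_ext => {x} v x.
rewrite -[LHS]/(hcast (cats0 (V :: u))
  (tjoin (V :: u) [::] (tens (tcons V u (tens v x)) a))) tjoin_cons.
rewrite [cats0 _](Prop_irrelevance _ (congr1 (cons V) (cats0 u))) -tcons_cast IH.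
by rewrite -[RHS]/(a *: tcons V u (tens v x)) -tensZ tensZl linearZ.
Qed.

Lemma tens_id0r f : f ⊠ idA [::] = f.
Proof.
case: f => u v f; apply: (Arr_eq (eu := cats0 u) (ev := cats0 v)) => x.
rewrite -[x]tsplitK; move: (tsplit _ _ x) => {}x.
apply: (tens_hom_ext (f := hcast (cats0 v) \o ((f ⊗ hid [::]) \o tjoin u [::]))
  (g := f \o (hcast (cats0 u) \o tjoin u [::]))) => {x} x a.
rewrite -[LHS]/(hcast (cats0 v) ((f ⊗ hid [::]) (tjoin u [::] (tens x a)))).
rewrite -[RHS]/(f (hcast (cats0 u) (tjoin u [::] (tens x a)))).
by rewrite htens_tjoin -[hid [::] a]/a !tjoin_nil_r linearZ.
Qed.
End Arrows.
Local Notation "f ⊠ g" := (tensor_arr f g) (at level 39, right associativity).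

(* The layer (u, g, v) stands for Id u ⊗ g ⊗ Id v, where letters and generators are
   represented by their indices; the first layer of a diagram is applied first. *)
Definition layer := (seq nat * nat * seq nat)%type.
Definition diagram := seq layer.

Inductive expr :=
| EGen of nat
| EId of seq nat
| EComp of expr & expr
| ETens of expr & expr.

Section Rewriting.
Variable sg : seq (seq nat * seq nat).
Implicit Types (l x y : layer) (d : diagram).

Definition gdom g := (nth ([::], [::]) sg g).1.
Definition gcod g := (nth ([::], [::]) sg g).2.

Definition shift (p q : seq nat) l : layer := (p ++ l.1.1, l.1.2, l.2 ++ q).

Fixpoint edom e := match e with
  | EGen g => gdom g | EId w => w | EComp _ f => edom f
  | ETens f g => edom f ++ edom g end.
Fixpoint ecod e := match e with
  | EGen g => gcod g | EId w => w | EComp g _ => ecod g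
  | ETens f g => ecod f ++ ecod g end.
Fixpoint flat e : diagram := match e with
  | EGen g => [:: ([::], g, [::])]
  | EId _ => [::]
  | EComp g f => flat f ++ flat g
  | ETens f g => map (shift [::] (edom g)) (flat f) ++ map (shift (ecod f) [::]) (flat g)
  end.

Definition ltgt l := l.1.1 ++ gcod l.1.2 ++ l.2.
Definition target w d := last w (map ltgt d).

(* The two exchanges of consecutive layers, according to whether y acts on the right
   or on the left of x; both may be possible when x has no output and y no input. *)
Definition swap_r x y : seq (layer * layer) :=
  let: (w1, g, w2) := x in let: (v1, h, v2) := y in
  let m := drop (size w1 + size (gcod g)) v1 in
  if (v1 == w1 ++ gcod g ++ m) && (w2 == m ++ gdom h ++ v2)
  then [:: ((w1 ++ gdom g ++ m, h, v2), (w1, g, m ++ gcod h ++ v2))] else [::].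
Definition swap_l x y : seq (layer * layer) :=
  let: (w1, g, w2) := x in let: (v1, h, v2) := y in
  let m := drop (size v1 + size (gdom h)) w1 in
  if (w1 == v1 ++ gdom h ++ m) && (v2 == m ++ gcod g ++ w2)
  then [:: ((v1, h, m ++ gdom g ++ w2), (v1 ++ gcod h ++ m, g, w2))] else [::].
Definition swap x y := swap_r x y ++ swap_l x y.

(** An exchange changes the words around both layers, so the moved layer is returned together with
    the altered rest; all outcomes are kept, since an exchange may be possible in two ways. *)
Fixpoint move_left d x : seq (layer * diagram) :=
  if d isn't y :: d' then [:: (x, [::])] else
  flatten [seq [seq (p2.1, p2.2 :: p1.2) | p2 <- swap y p1.1] | p1 <- move_left d' x].
Fixpoint move_right x d : seq (diagram * layer) :=
  if d isn't y :: d' then [:: ([::], x)] else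
  flatten [seq [seq (p1.1 :: p2.1, p2.2) | p2 <- move_right p1.2 d'] | p1 <- swap x y].

Fixpoint splits d : seq (diagram * layer * diagram) :=
  if d isn't x :: d' then [::] else
  ([::], x, d') :: [seq (x :: p.1.1, p.1.2, p.2) | p <- splits d'].

(** Equality up to interchange: each layer of [d2] in turn must be a layer of [d1] that can be
    brought to the front, where it is removed. *)
Fixpoint eqd d1 d2 : bool :=
  if d2 isn't l :: d2' then nilp d1 else
  has (fun s => has (fun m => (m.1 == l) && eqd (m.2 ++ s.2) d2') (move_left s.1.1 s.1.2))
      (splits d1).

(* Moves to the end everything in [rev ys] on which [blk] does not depend, except
   the layers without output: the words around the layers that follow them would
   otherwise record on which side of their input the latter have been placed. *)
Fixpoint pull (ys blk aft : diagram) : diagram * diagram :=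
  if ys isn't y :: ys' then (blk, aft) else
  if [seq p <- move_right y blk | gcod y.1.2 != [::]] is p :: _ then pull ys' p.1 (p.2 :: aft)
  else pull ys' (y :: blk) aft.

(** If [l] is [shift p q l0], this recovers [p] and [q], the wires that run on either side of the
    pattern. *)
Definition offset (l l0 : layer) :=
  (take (size l.1.1 - size l0.1.1) l.1.1, drop (size l0.2) l.2).

(* Extends the occurrence [blk] of a part of the pattern, [pats] being what is left
   of the latter, in the diagram [pre ++ blk ++ stuck ++ post]; the layers of [stuck]
   are those that could not be moved in front of [blk]. *)
Fixpoint grow n l0 pats pre blk stuck post : seq (diagram * diagram * diagram) :=
  if n isn't n'.+1 then [::] else
  if pats isn't q :: pats' then [:: (pre, blk, stuck ++ post)] else
  if post isn't x :: post' then [::] else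
  let pq := offset (head l0 blk) l0 in
  let ms := move_left stuck x in
  (if [seq m <- ms | m.1 == shift pq.1 pq.2 q] is m :: _ then
     grow n' l0 pats' pre (rcons blk m.1) [::] (m.2 ++ post') else [::]) ++
  if [seq (m', m.2) | m <- ms, m' <- move_left blk m.1] is m :: _ then
    grow n' l0 pats (rcons pre m.1.1) m.1.2 m.2 post'
  else grow n' l0 pats pre blk (rcons stuck x) post'.

Definition occurrences (lhs d : diagram) : seq (diagram * diagram * diagram) :=
  if lhs isn't l0 :: pats then [::] else
  (* Fuel for [grow]: soundness holds for every value, so the bound only decides which occurrences
     are found. *)
  let n := (size lhs * size d + size lhs + size d).+1 in
  flatten [seq (let p := pull (rev s.1.1) [:: s.1.2] [::] in
                if rev p.1 isn't x :: pre then [::] else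
                grow n l0 pats (rev pre) [:: x] [::] (p.2 ++ s.2))
          | s <- splits d & s.1.2.1.2 == l0.1.2].

Definition replace_at w (r : seq nat * diagram * diagram) p q
    (t : diagram * diagram * diagram) : seq diagram :=
  if (t.1.2 == map (shift p q) r.1.2) && (target w t.1.1 == p ++ r.1.1 ++ q)
  then [:: t.1.1 ++ map (shift p q) r.2 ++ t.2] else [::].

(** For a rule whose left-hand side is an identity, which occurs at every height of the diagram and
    at every position of the word there that fits. *)
Definition insertions (d : diagram) w (r : seq nat * diagram * diagram) : seq diagram :=
  flatten [seq (let pre := take j d in let v := target w pre in
     flatten [seq replace_at w r (take n v) (drop (n + size r.1.1) v) (pre, [::], drop j d)
             | n <- iota 0 (size v).+1])
  | j <- iota 0 (size d).+1].

Definition apply_rule w (r : seq nat * diagram * diagram) (d : diagram) : seq diagram :=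
  if r.1.2 is l0 :: _ then
    flatten [seq (let pq := offset (head l0 t.1.2) l0 in replace_at w r pq.1 pq.2 t)
            | t <- occurrences r.1.2 d]
  else insertions d w r.

Definition search w (rs : seq (seq nat * diagram * diagram)) d : seq diagram :=
  foldl (fun ds r => undup (flatten [seq apply_rule w r d | d <- ds])) [:: d] rs.

Definition rule_of (r : expr * expr) := (edom r.1, flat r.1, flat r.2).

Definition check (rs1 rs2 : seq (expr * expr)) (e1 e2 : expr) : bool :=
  (edom e1 == edom e2) &&
  (let s2 := search (edom e2) (map rule_of rs2) (flat e2) in
   has (fun d1 => has (eqd d1) s2) (search (edom e1) (map rule_of rs1) (flat e1))).

(** * Soundness of diagram rewriting *)

Section Semantics.
Variables (k : fieldType) (objs : seq (lmodType k)) (gens : seq (arr k)).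
Let obj n : lmodType k := nth (k^o : lmodType k) objs n.
Let word w := map obj w.
Hypothesis sgP : [seq (src a, tgt a) | a <- gens] = [seq (word s.1, word s.2) | s <- sg].

Definition gen g : arr k := nth (idA [::]) gens g.

(** Mapping the default as well covers indices out of range, where the generator is the identity of
    the empty word and the recorded words are empty. *)
Lemma nth_map_default T1 T2 (f : T1 -> T2) t0 s n : nth (f t0) (map f s) n = f (nth t0 s n).
Proof. by elim: s n => [|t s IH] [|n] //=. Qed.

Lemma gen_src g : src (gen g) = word (gdom g).
Proof.
have := nth_map_default (fun a : arr k => (src a, tgt a)) (idA [::]) gens g.
rewrite sgP -[(_, _)]/((fun s => (word s.1, word s.2)) ([::], [::])).
by rewrite nth_map_default /gdom /gen => -[->].
Qed.
Lemma gen_tgt g : tgt (gen g) = word (gcod g).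
Proof.
have := nth_map_default (fun a : arr k => (src a, tgt a)) (idA [::]) gens g.
rewrite sgP -[(_, _)]/((fun s => (word s.1, word s.2)) ([::], [::])).
by rewrite nth_map_default /gcod /gen => -[_ ->].
Qed.

Definition lay l : arr k := idA (word l.1.1) ⊠ gen l.1.2 ⊠ idA (word l.2).

Definition run (o : option (arr k)) d := foldl (fun o l => obind (comp (lay l)) o) o d.

(** Quantifying over every starting point, the undefined one included, makes this a congruence for
    concatenation. *)
Definition equiv d1 d2 := forall o, run o d1 = run o d2.

Lemma run_cat o d1 d2 : run o (d1 ++ d2) = run (run o d1) d2.
Proof. exact: foldl_cat. Qed.

Lemma run_none d : run None d = None.
Proof. by elim: d. Qed.

Lemma equiv_cat d1 d1' d2 d2' : equiv d1 d1' -> equiv d2 d2' -> equiv (d1 ++ d2) (d1' ++ d2').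
Proof. by move=> e1 e2 o; rewrite !run_cat e1 e2. Qed.

Lemma equiv_trans d2 d1 d3 : equiv d1 d2 -> equiv d2 d3 -> equiv d1 d3.
Proof. by move=> e1 e2 o; rewrite e1 e2. Qed.

Lemma word_cat u v : word (u ++ v) = word u ++ word v.
Proof. exact: map_cat. Qed.

Lemma idA_word_cat u v : idA (word (u ++ v)) = idA (word u) ⊠ idA (word v).
Proof. by rewrite word_cat tens_idA. Qed.

Lemma comp_id_gen_l g : comp (idA (word (gcod g))) (gen g) = Some (gen g).
Proof. by rewrite -gen_tgt comp_id_l. Qed.
Lemma comp_id_gen_r g : comp (gen g) (idA (word (gdom g))) = Some (gen g).
Proof. by rewrite -gen_src comp_id_r. Qed.
Lemma comp_id_word w : comp (idA (word w)) (idA (word w)) = Some (idA (word w)).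
Proof. exact: (comp_id_l (idA (word w))). Qed.

(** Both orders give [g] and [h] side by side; every exchange of layers is an instance. *)
Lemma interchange u g m h v :
  let mid := idA (word u) ⊠ gen g ⊠ idA (word m) ⊠ gen h ⊠ idA (word v) in
  comp (lay (u ++ gcod g ++ m, h, v)) (lay (u, g, m ++ gdom h ++ v)) = Some mid /\
  comp (lay (u, g, m ++ gcod h ++ v)) (lay (u ++ gdom g ++ m, h, v)) = Some mid.
Proof.
rewrite /lay /= !idA_word_cat !tensor_arrA.
by split; do ![apply: comp_tens]; rewrite ?comp_id_gen_l ?comp_id_gen_r ?comp_id_word.
Qed.

Lemma equiv_pair x y x' y' :
  comp (lay y) (lay x) = comp (lay y') (lay x') -> equiv [:: x; y] [:: x'; y'].
Proof. by move=> e [a|] //=; rewrite !compA e. Qed.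

Lemma swap_sound x y p : p \in swap x y -> equiv [:: x; y] [:: p.1; p.2].
Proof.
case: x y => [[w1 g] w2] [[v1 h] v2]; rewrite mem_cat => /orP[] /=;
  move: (drop _ _) => m; case: andP => // -[/eqP -> /eqP ->];
  rewrite inE => /eqP -> /=; apply: equiv_pair.
- by have [-> ->] := interchange w1 g m h v2.
by have [-> ->] := interchange v1 h m g w2.
Qed.

Lemma move_left_sound d x p : p \in move_left d x -> equiv (rcons d x) (p.1 :: p.2).
Proof.
elim: d p => [|y d IH] p /=; first by rewrite inE => /eqP ->.
case/flatten_mapP=> p1 /IH e1 /mapP[p2 /swap_sound e2 -> /=].
apply: (equiv_trans (d2 := [:: y; p1.1] ++ p1.2)).
  exact: (equiv_cat (d1 := [:: y]) (d1' := [:: y])).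
exact: (equiv_cat e2).
Qed.

Lemma move_right_sound x d p : p \in move_right x d -> equiv (x :: d) (rcons p.1 p.2).
Proof.
elim: d x p => [|y d IH] x p /=; first by rewrite inE => /eqP ->.
case/flatten_mapP=> p1 /swap_sound e1 /mapP[p2 /IH e2 -> /=].
apply: (equiv_trans (d2 := [:: p1.1; p1.2] ++ d)); first exact: (equiv_cat e1).
exact: (equiv_cat (d1 := [:: p1.1]) (d1' := [:: p1.1])).
Qed.

Lemma splits_sound d s : s \in splits d -> d = s.1.1 ++ s.1.2 :: s.2.
Proof.
elim: d s => //= x d IH s; rewrite inE => /predU1P[-> //|/mapP[p /IH -> ->]] //.
Qed.

Lemma eqd_sound d1 d2 : eqd d1 d2 -> equiv d1 d2.
Proof.
elim: d2 d1 => [|l d2 IH] d1 /=; first by case: d1.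
case/hasP=> s /splits_sound -> /hasP[m /move_left_sound em /andP[/eqP <- /IH e]].
apply: (equiv_trans (d2 := (m.1 :: m.2) ++ s.2)); last first.
  exact: (equiv_cat (d1 := [:: m.1]) (d1' := [:: m.1])).
by rewrite -cat_rcons; apply: equiv_cat.
Qed.

Lemma pull_sound ys blk aft :
  equiv (rev ys ++ blk ++ aft) ((pull ys blk aft).1 ++ (pull ys blk aft).2).
Proof.
elim: ys blk aft => //= y ys IH blk aft.
rewrite rev_cons cat_rcons.
case E: (filter _ _) => [|p ps]; first exact: (IH (y :: blk) aft).
apply: equiv_trans (IH _ _); apply: equiv_cat => //.
rewrite -[y :: _]/((y :: blk) ++ aft) -cat_rcons; apply: equiv_cat => //.
apply: move_right_sound.
have : p \in [seq p <- move_right y blk | gcod y.1.2 != [::]] by rewrite E mem_head.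
by rewrite mem_filter => /andP[].
Qed.

Lemma grow_sound n l0 pats pre blk stuck post t :
  t \in grow n l0 pats pre blk stuck post ->
  equiv (pre ++ blk ++ stuck ++ post) (t.1.1 ++ t.1.2 ++ t.2).
Proof.
elim: n pats pre blk stuck post => //= n IH [|q pats] pre blk stuck post.
  by rewrite inE => /eqP ->.
case: post => //= x post; rewrite mem_cat => /orP[].
  case E: (filter _ _) => [|m ms] //.
  have : m \in [seq m <- move_left stuck x |
      m.1 == shift (offset (head l0 blk) l0).1 (offset (head l0 blk) l0).2 q].
    by rewrite E mem_head.
  rewrite mem_filter => /andP[_ /move_left_sound e] /IH; apply: equiv_trans.
  apply: equiv_cat => //=; rewrite cat_rcons; apply: equiv_cat => //.
  by rewrite -cat_rcons -[m.1 :: _]/((m.1 :: m.2) ++ post); apply: equiv_cat.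
case E: (flatten _) => [|m ms]; first by move/IH; rewrite cat_rcons.
move/IH; apply: equiv_trans; rewrite cat_rcons; apply: equiv_cat => //.
have : m \in [seq (m', m.2) | m <- move_left stuck x, m' <- move_left blk m.1].
  by rewrite E mem_head.
case/flatten_mapP=> m1 /move_left_sound e1 /mapP[m2 /move_left_sound e2 ->] /=.
apply: (equiv_trans (d2 := blk ++ (m1.1 :: m1.2) ++ post)).
  by apply: equiv_cat => //; rewrite -cat_rcons; apply: equiv_cat.
rewrite -[(m1.1 :: _) ++ _]/(m1.1 :: (m1.2 ++ post)) -cat_rcons.
exact: (equiv_cat e2).
Qed.

Lemma occurrences_sound lhs d t :
  t \in occurrences lhs d -> equiv d (t.1.1 ++ t.1.2 ++ t.2).
Proof.
case: lhs => [//|l0 pats]; rewrite /occurrences; move: (_.+1) => n /flatten_mapP[s].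
rewrite mem_filter => /andP[_ /splits_sound ed].
set p := pull _ _ _.
have ep : equiv (s.1.1 ++ [:: s.1.2]) (p.1 ++ p.2).
  by rewrite -[s.1.1]revK; exact: (pull_sound _ [:: s.1.2] [::]).
have {ep} ed : equiv d (p.1 ++ p.2 ++ s.2).
  by rewrite ed -cat_rcons -cats1 catA; apply: equiv_cat.
case E: (rev p.1) => [|x pre] //= /grow_sound; apply: equiv_trans.
by move: ed; rewrite -[p.1]revK E rev_cons cat_rcons.
Qed.

Lemma lay_shift p q l : lay (shift p q l) = idA (word p) ⊠ lay l ⊠ idA (word q).
Proof. by rewrite /lay /= !idA_word_cat !tensor_arrA. Qed.

Lemma run_shift p q d a r : run (Some a) d = Some r ->
  run (Some (idA (word p) ⊠ a ⊠ idA (word q))) (map (shift p q) d) =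
  Some (idA (word p) ⊠ r ⊠ idA (word q)).
Proof.
elim: d a => [|l d IH] a /=; first by case=> ->.
case E: (comp (lay l) a) => [b|]; last by rewrite run_none.
move/IH => <-; congr run; rewrite lay_shift.
by do ![apply: comp_tens]; rewrite ?comp_id_word.
Qed.

Lemma run_pre o (a : arr k) d :
  run (obind ((@comp k) ^~ a) o) d = obind ((@comp k) ^~ a) (run o d).
Proof.
elim: d o => //= l d IH [b|] /=; last by rewrite !run_none.
by rewrite compA IH.
Qed.

Lemma run_from (a : arr k) w d : tgt a = word w ->
  run (Some a) d = obind ((@comp k) ^~ a) (run (Some (idA (word w))) d).
Proof. by move=> ta; rewrite -run_pre /= -ta comp_id_l. Qed.

Lemma run_target w d a b : run (Some a) d = Some b -> tgt a = word w ->
  tgt b = word (target w d).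
Proof.
elim: d w a => [|l d IH] w a /=; first by case=> ->.
case E: (comp _ _) => [c|]; last by rewrite run_none.
move=> /IH e _; rewrite /target /=; apply: e.
have [_ _ ->] := comp_some E.
by rewrite /ltgt !word_cat -gen_tgt.
Qed.

(** The common value has to be defined, because [run_shift] carries only defined composites into a
    context. *)
Definition valid_rule (r : seq nat * diagram * diagram) := exists2 a : arr k,
  run (Some (idA (word r.1.1))) r.1.2 = Some a & run (Some (idA (word r.1.1))) r.2 = Some a.

Lemma replace_at_sound w r p q t d : valid_rule r ->
  d \in replace_at w r p q t ->
  run (Some (idA (word w))) (t.1.1 ++ t.1.2 ++ t.2) = run (Some (idA (word w))) d.
Proof.
case=> a e1 e2; rewrite /replace_at; case: andP => // -[/eqP -> /eqP tw].
rewrite inE => /eqP ->; rewrite !run_cat.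
case E: (run _ t.1.1) => [b|]; last by rewrite !run_none.
have := run_target E (erefl : tgt (idA (word w)) = _).
rewrite tw => tb; congr run; rewrite !(run_from _ tb) !idA_word_cat.
by rewrite (run_shift p q e1) (run_shift p q e2).
Qed.

Lemma apply_rule_sound w r d d' : valid_rule r -> d' \in apply_rule w r d ->
  run (Some (idA (word w))) d = run (Some (idA (word w))) d'.
Proof.
move=> vr; rewrite /apply_rule; case E: r.1.2 => [|l0 lhs].
  case/flatten_mapP=> j _ /flatten_mapP[n _ /(replace_at_sound vr) <-].
  by rewrite /= cat_take_drop.
by case/flatten_mapP=> t /occurrences_sound -> /(replace_at_sound vr).
Qed.

Lemma search_sound w rs d d' : (forall r, r \in rs -> valid_rule r) ->
  d' \in search w rs d -> run (Some (idA (word w))) d = run (Some (idA (word w))) d'.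
Proof.
move=> vrs; rewrite /search.
have: forall d1, d1 \in [:: d] ->
    run (Some (idA (word w))) d = run (Some (idA (word w))) d1.
  by move=> d1; rewrite inE => /eqP ->.
elim: rs [:: d] vrs => /= [|r rs IH] ds vrs eds; first exact: eds.
apply: IH => [r' hr'|d1]; first by apply: vrs; rewrite inE hr' orbT.
rewrite mem_undup => /flatten_mapP[d2 /eds -> /apply_rule_sound]; apply.
by apply: vrs; rewrite mem_head.
Qed.

Fixpoint den e : option (arr k) := match e with
  | EGen g => Some (gen g)
  | EId w => Some (idA (word w))
  | EComp g f => obind (fun a => obind ((@comp k) ^~ a) (den g)) (den f)
  | ETens f g => obind (fun a => omap (@tensor_arr k a) (den g)) (den f)
  end.

Lemma den_flat e a : den e = Some a ->
  [/\ src a = word (edom e), tgt a = word (ecod e)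
    & run (Some (idA (word (edom e)))) (flat e) = Some a].
Proof.
elim: e a => [g|w|g IHg f IHf|f IHf g IHg] a /=.
- by case=> <-; rewrite gen_src gen_tgt /lay /= tens_id0r tens_id0l comp_id_gen_r.
- by case=> <-.
- case: (den f) IHf => [b|] //= /(_ _ erefl)[sb tb rb].
  case: (den g) IHg => [c|] //= /(_ _ erefl)[sc tc rc] E.
  have [e -> ->] := comp_some E; split=> //.
  by rewrite run_cat rb (run_from (w := edom g)) ?rc -?sc.
case: (den f) IHf => [b|] //= /(_ _ erefl)[sb tb rb].
case: (den g) IHg => [c|] //= /(_ _ erefl)[sc tc rc] [<-] /=.
rewrite !word_cat sb sc tb tc; split=> //.
rewrite -word_cat run_cat idA_word_cat.
rewrite -[_ ⊠ _]tens_id0l (run_shift [::] (edom g) rb) /= tens_id0l.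
rewrite (run_from (w := ecod f ++ edom g)); last by rewrite /= word_cat tb.
have := run_shift (ecod f) [::] rc; rewrite /= !tens_id0r idA_word_cat => -> /=.
by apply: comp_tens; rewrite -?tb -?sc ?comp_id_l ?comp_id_r.
Qed.

Definition repr e u v (f : Hom u v) := den e = Some (Arr f).

Lemma repr_gen g u v (f : Hom u v) : gen g = Arr f -> repr (EGen g) f.
Proof. by rewrite /repr /= => ->. Qed.
Lemma repr_id w : repr (EId w) (hid (word w)).
Proof. by []. Qed.
Lemma repr_comp e1 e2 u v w (g : Hom v w) (f : Hom u v) :
  repr e1 g -> repr e2 f -> repr (EComp e1 e2) (g ∘ f).
Proof. by rewrite /repr /= => -> -> /=; rewrite compE. Qed.
Lemma repr_tens e1 e2 u v u' v' (f : Hom u v) (g : Hom u' v') :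
  repr e1 f -> repr e2 g -> repr (ETens e1 e2) (f ⊗ g).
Proof. by rewrite /repr /= => -> -> /=. Qed.

Fixpoint rules_hold (rs : seq (expr * expr)) : Prop :=
  if rs isn't r :: rs' then True else
  (exists2 a, den r.1 = Some a & den r.2 = Some a) /\ rules_hold rs'.

Lemma rules_cons e1 e2 rs u v (f g : Hom u v) :
  f = g -> repr e1 f -> repr e2 g -> rules_hold rs -> rules_hold ((e1, e2) :: rs).
Proof. by move=> <- r1 r2 h; split=> //; exists (Arr f). Qed.

(** The reflection principle of the tactic: once reified, an equation of maps is settled by
    evaluating [check]. *)
Lemma diagram_rewriting rs1 rs2 e1 e2 u v (f g : Hom u v) :
  rules_hold rs1 -> rules_hold rs2 -> repr e1 f -> repr e2 g ->
  check rs1 rs2 e1 e2 -> f = g.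
Proof.
move=> h1 h2 r1 r2 /andP[/eqP ed].
have valid rs : rules_hold rs -> forall r, r \in map rule_of rs -> valid_rule r.
  elim: rs => //= r rs IH [[a /den_flat[sa _ ra] /den_flat[sa' _ ra']] /IH h] r'.
  by rewrite inE => /predU1P[->|/h //]; exists a; rewrite //= -sa sa'.
case/hasP=> d1 /(search_sound (valid _ h1)) e1d /hasP[d2 /(search_sound (valid _ h2)) e2d].
move/eqd_sound=> e12; apply: Arr_inj.
suff E : Some (Arr f) = Some (Arr g) by apply: (congr1 (odflt (Arr f)) E).
have [_ _ <-] := den_flat r1; have [_ _ <-] := den_flat r2.
by rewrite e1d e2d e12 ed.
Qed.
End Semantics.
End Rewriting.

(** * Reification of equations between maps *)

Ltac diag_index x l :=
  lazymatch l with
  | cons x _ => constr:(O)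
  | cons _ ?l' => let n := diag_index x l' in constr:(S n)
  end.
Ltac diag_gen_index g l :=
  lazymatch l with
  | cons (@Arr _ _ _ g) _ => constr:(O)
  | cons _ ?l' => let n := diag_gen_index g l' in constr:(S n)
  end.
Ltac diag_codes ls w :=
  lazymatch w with
  | nil => constr:(@nil nat)
  | cons ?V ?w' =>
    let n := diag_index V ls in let c := diag_codes ls w' in constr:(@cons nat n c)
  end.
Ltac diag_add_letters ls w :=
  lazymatch w with
  | nil => ls
  | cons ?V ?w' =>
    let ls := match ls with
      | context [@cons _ V _] => ls
      | _ => constr:(cons V ls)
      end in
    diag_add_letters ls w'
  end.
Ltac diag_collect e t :=
  lazymatch t with
  | @hcomp _ _ _ _ ?g ?f => let e := diag_collect e f in diag_collect e g
  | @htens _ _ _ _ _ ?f ?g => let e := diag_collect e f in diag_collect e g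
  | @Id _ ?V =>
    lazymatch e with pair ?ls ?gs =>
      let ls := diag_add_letters ls constr:(cons V nil) in constr:(pair ls gs) end
  | @hid _ ?w =>
    let w := eval cbn in w in
    lazymatch e with pair ?ls ?gs =>
      let ls := diag_add_letters ls w in constr:(pair ls gs) end
  | ?g =>
    lazymatch e with pair ?ls ?gs =>
      match gs with
      | context [@Arr _ _ _ g] => e
      | _ =>
        lazymatch type of g with @Hom ?k ?u ?v =>
          let u := eval cbn in u in let v := eval cbn in v in
          let ls := diag_add_letters ls u in let ls := diag_add_letters ls v in
          constr:(pair ls (cons (@Arr k u v g) gs)) end
      end
    end
  end.
Ltac diag_collect_rules e rs :=
  lazymatch rs with
  | pair ?rs1 ?rs2 => let e := diag_collect_rules e rs1 in diag_collect_rules e rs2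
  | tt => e
  | ?r => lazymatch type of r with @eq _ ?f ?g =>
      let e := diag_collect e f in diag_collect e g end
  end.
Ltac diag_sig ls gs :=
  lazymatch gs with
  | nil => constr:(@nil (seq nat * seq nat))
  | cons (@Arr _ ?u ?v _) ?gs' =>
    let cu := diag_codes ls u in let cv := diag_codes ls v in
    let s := diag_sig ls gs' in constr:(cons (cu, cv) s)
  end.
Ltac diag_reify ls gs t :=
  lazymatch t with
  | @hcomp ?k ?u ?v ?w ?g ?f =>
    let rg := diag_reify ls gs g in let rf := diag_reify ls gs f in
    constr:(@repr_comp k ls gs _ _ u v w g f rg rf)
  | @htens ?k ?u ?u' ?v ?v' ?f ?g =>
    let rf := diag_reify ls gs f in let rg := diag_reify ls gs g in
    constr:(@repr_tens k ls gs _ _ u u' v v' f g rf rg)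
  | @Id _ ?V =>
    let c := diag_codes ls constr:(cons V nil) in constr:(repr_id ls gs c)
  | @hid _ ?w =>
    let w := eval cbn in w in
    let c := diag_codes ls w in constr:(repr_id ls gs c)
  | ?g =>
    let n := diag_gen_index g gs in
    lazymatch type of g with @Hom ?k ?u ?v =>
      constr:(@repr_gen k ls gs n u v g erefl) end
  end.
Ltac diag_reify_rules k ls gs rs acc :=
  lazymatch rs with
  | pair ?rs1 ?rs2 =>
    let acc := diag_reify_rules k ls gs rs2 acc in diag_reify_rules k ls gs rs1 acc
  | tt => acc
  | ?r => lazymatch type of r with @eq _ ?f ?g =>
      let rf := diag_reify ls gs f in let rg := diag_reify ls gs g in
      constr:(rules_cons r rf rg acc) end
  end.
Ltac diagram_goal k rs1 rs2 f g :=
  let e := constr:(pair (@nil (lmodType k)) (@nil (arr k))) in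
  let e := diag_collect e f in let e := diag_collect e g in
  let e := diag_collect_rules e rs1 in let e := diag_collect_rules e rs2 in
  lazymatch e with pair ?ls ?gs =>
    let sg := diag_sig ls gs in
    let rf := diag_reify ls gs f in let rg := diag_reify ls gs g in
    let h0 := constr:(I : @rules_hold k ls gs [::]) in
    let h1 := diag_reify_rules k ls gs rs1 h0 in
    let h2 := diag_reify_rules k ls gs rs2 h0 in
    refine (@diagram_rewriting sg k ls gs erefl _ _ _ _ _ _ _ _ h1 h2 rf rg _);
    vm_compute; reflexivity
  end.
(* [diagram L to R] rewrites the left-hand side of an equality of maps with the
   equations of the tuple L, once each and in order, the right-hand side with those
   of R, and compares the results. Occurrences are found up to the interchange law,
   but those of a disconnected left-hand side may be missed. *)
Tactic Notation "diagram" constr(rs1) "to" constr(rs2) :=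
  lazymatch goal with |- @eq (@Hom ?k _ _) ?f ?g => diagram_goal k rs1 rs2 f g end.
Tactic Notation "diagram" constr(rs1) := diagram rs1 to tt.

(** * Convolution and bijectivity *)

Section Isomorphisms.
Variable k : fieldType.
Local Notation word := (seq (lmodType k)).

Definition iso (u v : word) (f : Hom u v) :=
  exists2 g : Hom v u, g ∘ f = hid u & f ∘ g = hid v.

Lemma bijective_iso (u v : word) (f : Hom u v) : bijective f -> iso f.
Proof.
case=> g fK gK.
have gl : linear g.
  by move=> a x y; apply: (can_inj fK); rewrite linearP !gK.
by exists (linmap gl); apply: hom_ext => x /=.
Qed.

Lemma iso_bijective (u v : word) (f : Hom u v) : iso f -> bijective f.
Proof.
case=> g gf fg; exists g => x.
  by rewrite -[LHS]/((g ∘ f) x) gf.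
by rewrite -[LHS]/((f ∘ g) x) fg.
Qed.

Lemma hcancel (u v : word) (f : Hom u v) (g : Hom v u) : cancel f g -> g ∘ f = @hid k u.
Proof. by move=> fK; apply: hom_ext => x; apply: fK. Qed.

Lemma iso_comp (u v w : word) (f : Hom u v) (g : Hom v w) : iso f -> iso g -> iso (g ∘ f).
Proof.
move=> /iso_bijective bf /iso_bijective bg; apply: bijective_iso.
exact: (bij_comp bg bf).
Qed.

Lemma retract_inj (u v w : word) (r : Hom v u) (m : Hom u v) (f g : Hom w u) :
  r ∘ m = hid u -> m ∘ f = m ∘ g -> f = g.
Proof.
move=> rm mfg; apply: hom_ext => x.
rewrite -[f x]/(hid u (f x)) -[g x]/(hid u (g x)) -rm.
by rewrite -[LHS]/(r ((m ∘ f) x)) mfg.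
Qed.

Lemma inj_cancel (u v w : word) (m : Hom u v) (f g : Hom w u) :
  injective m -> m ∘ f = m ∘ g -> f = g.
Proof.
move=> mi mfg; apply: hom_ext => x; apply: mi.
by rewrite -[LHS]/((m ∘ f) x) mfg.
Qed.

Lemma scalar_ext (w : word) (f g : Hom [::] w) : f (1 : k^o) = g (1 : k^o) -> f = g.
Proof.
move=> fg; apply: hom_ext => a.
by rewrite -[a]mulr1 -[_ * _]/(a *: (1 : k^o)) !linearZ fg.
Qed.

Lemma htens_scalar (U V : lmodType k) (f : Hom [::] ⟨U⟩) (g : Hom [::] ⟨V⟩) :
  (f ⊗ g) (1 : k^o) = tens (f (1 : k^o)) (g (1 : k^o)).
Proof.
have -> : (1 : k^o) = tjoin [::] [::] (tens (1 : k^o) (1 : k^o)).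
  by rewrite /= lunitE scale1r.
by rewrite htens_tjoin tjoin11 /= lunitE scale1r.
Qed.

Lemma htens_unit_r (V W : lmodType k) (g : Hom [::] ⟨W⟩) (v : V) :
  (Id V ⊗ g) v = tens v (g (1 : k^o)).
Proof.
by rewrite /= !(tmapE, tassocVE, tassocE, runitE, lunitE) !scale1r.
Qed.
End Isomorphisms.

Section AlgebraLaws.
Variables (k : fieldType) (X : algebra k).
Lemma muA : mu X ∘ (mu X ⊗ Id X) = mu X ∘ (Id X ⊗ mu X).
Proof. by have [] := algebraP X. Qed.
Lemma mu1l : mu X ∘ (eta X ⊗ Id X) = Id X.
Proof. by have [] := algebraP X. Qed.
Lemma mu1r : mu X ∘ (Id X ⊗ eta X) = Id X.
Proof. by have [] := algebraP X. Qed.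
End AlgebraLaws.

Section Convolution.
Variables (k : fieldType) (X : algebra k).

Section OneLetter.
Variables (C : lmodType k) (D : Hom ⟨C⟩ ⟨C; C⟩) (e : Hom ⟨C⟩ [::]).
Hypothesis coalg : is_coalgebra D e.
Let DA : (D ⊗ Id C) ∘ D = (Id C ⊗ D) ∘ D. Proof. by case: coalg. Qed.
Let e1l : (e ⊗ Id C) ∘ D = Id C. Proof. by case: coalg. Qed.
Let e1r : (Id C ⊗ e) ∘ D = Id C. Proof. by case: coalg. Qed.

Definition conv_map (f : Hom ⟨C⟩ ⟨X⟩) : Hom ⟨X; C⟩ ⟨X; C⟩ :=
  (mu X ⊗ Id C) ∘ (Id X ⊗ f ⊗ Id C) ∘ (Id X ⊗ D).

(** Convolution becomes composition in the reverse order: x ⊗ h goes to x f(h₁) g(h₂) ⊗ h₃. *)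
Lemma conv_map_comp (f g : Hom ⟨C⟩ ⟨X⟩) : mu X ∘ (f ⊗ g) ∘ D = eta X ∘ e ->
  conv_map g ∘ conv_map f = hid ⟨X; C⟩.
Proof.
move=> fg; rewrite /conv_map.
diagram (esym DA, muA X, fg, mu1r X, e1l).
Qed.

(** An inverse [W] of T_f inherits left X-linearity and right C-colinearity from T_f. Such a map is
    T_u, where [u] is read off by inserting 1 on the left and applying the counit on the right, and
    this [u] inverts [f]. *)
Lemma conv_map_iso f : conv_invertible D e f <-> iso (conv_map f).
Proof.
split=> [[g [fg gf]]|[W WT TW]].
  by exists (conv_map g); apply: conv_map_comp.
set T := conv_map f in WT TW.
have TL : T ∘ (mu X ⊗ Id C) = (mu X ⊗ Id C) ∘ (Id X ⊗ T).
  rewrite /T /conv_map; diagram (muA X).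
have TD : (Id X ⊗ D) ∘ T = (T ⊗ Id C) ∘ (Id X ⊗ D).
  rewrite /T /conv_map; diagram (esym DA).
have WL : W ∘ (mu X ⊗ Id C) = (mu X ⊗ Id C) ∘ (Id X ⊗ W).
  apply: (retract_inj WT); diagram (TW) to (TL, TW).
have WD : (Id X ⊗ D) ∘ W = (W ⊗ Id C) ∘ (Id X ⊗ D).
  diagram (esym WT, esym TD, TW).
pose u : Hom ⟨C⟩ ⟨X⟩ := (Id X ⊗ e) ∘ W ∘ (eta X ⊗ Id C).
have Wu : W = conv_map u.
  rewrite /conv_map /u; diagram tt to (esym WD, e1l, esym WL, mu1r X).
have conv (g h : Hom ⟨C⟩ ⟨X⟩) : mu X ∘ (g ⊗ h) ∘ D =
    (Id X ⊗ e) ∘ conv_map h ∘ conv_map g ∘ (eta X ⊗ Id C).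
  rewrite /conv_map; diagram tt to (esym DA, e1r, mu1l X).
exists u; split; rewrite /convol conv -Wu -/T.
  diagram WT.
diagram TW.
Qed.
End OneLetter.
End Convolution.

Section BialgebraLaws.
Variables (k : fieldType) (H : braided_bialgebra k).

Lemma DeltaA : (Delta H ⊗ Id H) ∘ Delta H = (Id H ⊗ Delta H) ∘ Delta H.
Proof. by have [] := coalgebraP H. Qed.
Lemma eps1l : (eps H ⊗ Id H) ∘ Delta H = Id H.
Proof. by have [] := coalgebraP H. Qed.
Lemma eps1r : (Id H ⊗ eps H) ∘ Delta H = Id H.
Proof. by have [] := coalgebraP H. Qed.
Lemma Delta_eta : Delta H ∘ eta H = eta H ⊗ eta H.
Proof. by have [] := eta_coalgP H. Qed.
Lemma eps_eta : eps H ∘ eta H = hid [::].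
Proof. by have [] := eta_coalgP H. Qed.
Lemma braid_eta_r : braid H ∘ (Id H ⊗ eta H) = eta H ⊗ Id H.
Proof. by have [_ []] := braid_algP H. Qed.
Lemma braid_eps_l : (Id H ⊗ eps H) ∘ braid H = eps H ⊗ Id H.
Proof. by have [[]] := braid_coalgP H. Qed.
Lemma braid_Delta_l : (Id H ⊗ Delta H) ∘ braid H =
  (braid H ⊗ Id H) ∘ (Id H ⊗ braid H) ∘ (Delta H ⊗ Id H).
Proof. by have [[]] := braid_coalgP H. Qed.
Lemma braid_eps_r : (eps H ⊗ Id H) ∘ braid H = Id H ⊗ eps H.
Proof. by have [_ []] := braid_coalgP H. Qed.
Lemma braid_Delta_r : (Delta H ⊗ Id H) ∘ braid H =
  (Id H ⊗ braid H) ∘ (braid H ⊗ Id H) ∘ (Id H ⊗ Delta H).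
Proof. by have [_ []] := braid_coalgP H. Qed.

(** The tactic [diagram] treats [Delta2 H] as an atomic generator; used as a rule, this equation
    unfolds it. *)
Lemma Delta2E : Delta2 H = (Id H ⊗ braid H ⊗ Id H) ∘ (Delta H ⊗ Delta H).
Proof. by []. Qed.

Lemma Delta2A : (Delta2 H ⊗ Id H ⊗ Id H) ∘ Delta2 H = (Id H ⊗ Id H ⊗ Delta2 H) ∘ Delta2 H.
Proof.
rewrite Delta2E.
diagram (braid_Delta_r, DeltaA, DeltaA) to braid_Delta_l.
Qed.
Lemma eps2_1l : (eps H ⊗ eps H ⊗ Id H ⊗ Id H) ∘ Delta2 H = Id H ⊗ Id H.
Proof. rewrite Delta2E; diagram (braid_eps_r, eps1l, eps1l). Qed.
Lemma eps2_1r : (Id H ⊗ Id H ⊗ eps H ⊗ eps H) ∘ Delta2 H = Id H ⊗ Id H.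
Proof. rewrite Delta2E; diagram (braid_eps_l, eps1r, eps1r). Qed.

(* The tensor square as a single letter, to which conv_map_iso applies. *)
Definition pair_in : Hom ⟨H; H⟩ ⟨tensor H H⟩ := hid ⟨H; H⟩.
Definition pair_out : Hom ⟨tensor H H⟩ ⟨H; H⟩ := hid ⟨H; H⟩.
Lemma pair_inK : pair_out ∘ pair_in = hid ⟨H; H⟩. Proof. exact: hom_ext. Qed.
Lemma pair_outK : pair_in ∘ pair_out = Id (tensor H H). Proof. exact: hom_ext. Qed.

Variable X : algebra k.

Definition conv_map2 (f : Hom ⟨H; H⟩ ⟨X⟩) : Hom ⟨X; H; H⟩ ⟨X; H; H⟩ :=
  (mu X ⊗ Id H ⊗ Id H) ∘ (Id X ⊗ f ⊗ Id H ⊗ Id H) ∘ (Id X ⊗ Delta2 H).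

Lemma conv_map2_iso (f : Hom ⟨H; H⟩ ⟨X⟩) :
  conv_invertible (C := ⟨H; H⟩) (Delta2 H) (eps H ⊗ eps H) f <-> iso (conv_map2 f).
Proof.
pose D : Hom ⟨tensor H H⟩ ⟨tensor H H; tensor H H⟩ :=
  (pair_in ⊗ pair_in) ∘ Delta2 H ∘ pair_out.
pose e : Hom ⟨tensor H H⟩ [::] := (eps H ⊗ eps H) ∘ pair_out.
have coalg : is_coalgebra D e.
  split; rewrite /D /e.
  - diagram (pair_inK, Delta2A) to pair_inK.
  - diagram (pair_inK, eps2_1l, pair_outK).
  diagram (pair_inK, eps2_1r, pair_outK).
have Tf : conv_map D (f ∘ pair_out) =
    (Id X ⊗ pair_in) ∘ conv_map2 f ∘ (Id X ⊗ pair_out).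
  rewrite /conv_map /conv_map2 /D; diagram pair_inK.
have inP : iso (Id X ⊗ pair_in).
  exists (Id X ⊗ pair_out); [diagram pair_inK | diagram pair_outK].
have outP : iso (Id X ⊗ pair_out).
  exists (Id X ⊗ pair_in); [diagram pair_outK | diagram pair_inK].
have Tf' : conv_map2 f =
    (Id X ⊗ pair_out) ∘ conv_map D (f ∘ pair_out) ∘ (Id X ⊗ pair_in).
  rewrite Tf; diagram tt to (pair_inK, pair_inK).
have [inv_iso iso_inv] := conv_map_iso coalg (f ∘ pair_out).
split=> [[g [fg gf]]|Tiso].
  rewrite Tf'; apply: (iso_comp inP (iso_comp (inv_iso _) outP)).
  exists (g ∘ pair_out); split; rewrite /convol /D /e.
    rewrite /convol in fg; diagram (pair_inK, pair_inK, fg).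
  rewrite /convol in gf; diagram (pair_inK, pair_inK, gf).
have [|g [fg gf]] := iso_inv.
  by rewrite Tf; exact: (iso_comp outP (iso_comp Tiso inP)).
exists (g ∘ pair_in); move: fg gf; rewrite /convol /D /e => fg gf.
split; rewrite /convol.
  diagram tt to (esym pair_inK, esym fg, pair_inK, pair_inK).
diagram tt to (esym pair_inK, esym gf, pair_inK, pair_inK).
Qed.
End BialgebraLaws.

(** * Extensions with a normal basis *)

Lemma tjoin21 (k : fieldType) (U V W : lmodType k) (u : U) (v : V) (w : W) :
  tjoin ⟨U; V⟩ ⟨W⟩ (tens (tens u v) w) = tens u (tens v w).
Proof.
rewrite -[tens u v]/(tcons U ⟨V⟩ (tens u v)) (tjoin_cons (u := ⟨V⟩)).
by rewrite (tjoin11 v w).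
Qed.

Lemma tjoin12 (k : fieldType) (U V W : lmodType k) (u : U) (y : tensor V W) :
  tjoin ⟨U⟩ ⟨V; W⟩ (tens u y) = tens u y.
Proof. by rewrite /= !(tmapE, tassocE, lunitE) scale1r. Qed.

Section ComoduleAlgebraLaws.
Variables (k : fieldType) (H : braided_bialgebra k) (B : comodule_algebra H).

Lemma coact_eta : coact B ∘ eta B = eta B ⊗ eta H.
Proof. by apply: scalar_ext; rewrite htens_scalar; apply: coact_one. Qed.
Lemma transp_eta_l : transp B ∘ (eta H ⊗ Id B) = Id B ⊗ eta H.
Proof. by have [[_ []]] := transpP B. Qed.
Lemma transp_eta_r : transp B ∘ (Id H ⊗ eta B) = eta B ⊗ Id H.
Proof. by have [_ []] := transpP B. Qed.
Lemma transp_mu_r : transp B ∘ (Id H ⊗ mu B) =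
  (mu B ⊗ Id H) ∘ (Id B ⊗ transp B) ∘ (transp B ⊗ Id B).
Proof. by have [_ []] := transpP B. Qed.
End ComoduleAlgebraLaws.

Section Extension.
Variables (k : fieldType) (H : braided_bialgebra k) (A : algebra k).
Variables (B : comodule_algebra H) (i : Hom ⟨A⟩ ⟨B⟩).
Hypothesis ext : H_extension i.

Lemma ext_inj : injective i. Proof. by case: ext. Qed.
Lemma ext_mu : i ∘ mu A = mu B ∘ (i ⊗ i). Proof. by case: ext => [[]]. Qed.
Lemma ext_eta : i ∘ eta A = eta B. Proof. by case: ext => [[]]. Qed.

Lemma ext_coact : coact B ∘ i = (Id B ⊗ eta H) ∘ i.
Proof.
case: ext => _ _ coinvP; apply: hom_ext => a.
rewrite -[RHS]/((Id B ⊗ eta H) (i a)) htens_unit_r.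
by apply/coinvP; exists a.
Qed.

(** Preimages under [i] are chosen pointwise; injectivity of [i] makes the choice linear. *)
Lemma coinvariant_factor (w : seq (lmodType k)) (f : Hom w ⟨B⟩) :
  coact B ∘ f = (Id B ⊗ eta H) ∘ f -> exists g : Hom w ⟨A⟩, i ∘ g = f.
Proof.
move=> fc; have fA x : exists a, i a = f x.
  case: ext => _ _ coinvP; apply/coinvP.
  by rewrite /coinvariant -[LHS]/((coact B ∘ f) x) fc -htens_unit_r.
pose g x := projT1 (cid (fA x)).
have ig x : i (g x) = f x by rewrite /g; case: (cid _).
have gl : linear g by move=> a x y; apply: ext_inj; rewrite linearP !ig linearP.
by exists (linmap gl); apply: hom_ext => x; apply: ig.
Qed.

Lemma induced_transpP : (exists sA, induced_transp_spec i sA) ->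
  induced_transp_spec i (induced_transp i).
Proof. by rewrite /induced_transp => ex; case: pselect => // ex'; case: (cid ex'). Qed.

Section NormalBasis.
Variables (phi : Hom ⟨A; H⟩ ⟨B⟩) (phiV : Hom ⟨B⟩ ⟨A; H⟩).
Hypothesis phiK : phiV ∘ phi = hid ⟨A; H⟩.
Hypothesis phiVK : phi ∘ phiV = Id B.
Hypothesis phiL : phi ∘ (mu A ⊗ Id H) = mu B ∘ (i ⊗ phi).
Hypothesis phiC : coact B ∘ phi = (phi ⊗ Id H) ∘ (Id A ⊗ Delta H).

Definition basis_section : Hom ⟨H⟩ ⟨B⟩ := phi ∘ (eta A ⊗ Id H).
Local Notation gamma := basis_section.
Let gammaE : gamma = phi ∘ (eta A ⊗ Id H). Proof. by []. Qed.

Lemma basis_sectionE : phi = mu B ∘ (i ⊗ gamma).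
Proof. diagram tt to (gammaE, esym phiL, mu1r A). Qed.

Lemma basis_section_colinear : coact B ∘ gamma = (gamma ⊗ Id H) ∘ Delta H.
Proof. diagram (gammaE, phiC) to gammaE. Qed.

Lemma coact_basis_inverse : (Id A ⊗ Delta H) ∘ phiV = (phiV ⊗ Id H) ∘ coact B.
Proof. diagram tt to (esym phiVK, phiC, phiK). Qed.

(** If b is coinvariant, colinearity of φ⁻¹ gives φ⁻¹(b) = a ⊗ 1 with a = (A ⊗ ε)φ⁻¹(b), so b = i(a)
    γ(1). As γ(1) is itself coinvariant, say i(w), this is b = i(a w), and p(b) = a w defines a
    retraction of [i]. It also factors s ∘ (H ⊗ i), whose values are coinvariant in the factor B. *)
Lemma transp_exists : exists p sA, p ∘ i = Id A /\ induced_transp_spec i sA.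
Proof.
have [|w iw] := @coinvariant_factor [::] (gamma ∘ eta H).
  diagram (basis_section_colinear, Delta_eta H).
pose p : Hom ⟨B⟩ ⟨A⟩ := mu A ∘ (((Id A ⊗ eps H) ∘ phiV) ⊗ w).
have ip : i ∘ p = mu B ∘ (i ⊗ gamma) ∘ (Id A ⊗ eta H) ∘ (Id A ⊗ eps H) ∘ phiV.
  rewrite /p; diagram (ext_mu, iw).
(* The same argument with a spectator factor H. *)
have key (x : Hom ⟨H; A⟩ ⟨B; H⟩) :
    (coact B ⊗ Id H) ∘ x = (Id B ⊗ eta H ⊗ Id H) ∘ x -> x = ((i ∘ p) ⊗ Id H) ∘ x.
  move=> xc; have y : (phiV ⊗ Id H) ∘ x =
      (((Id A ⊗ eta H) ∘ (Id A ⊗ eps H) ∘ phiV) ⊗ Id H) ∘ x.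
    diagram (esym (eps1l H), coact_basis_inverse, xc).
  diagram tt to (ip, esym basis_sectionE, esym y, phiVK).
have pi : p ∘ i = Id A.
  apply: (inj_cancel ext_inj).
  have y : phiV ∘ i = (Id A ⊗ eta H) ∘ (Id A ⊗ eps H) ∘ phiV ∘ i.
    diagram (esym (eps1l H), coact_basis_inverse, ext_coact).
  diagram (ip, esym basis_sectionE, esym y, phiVK).
exists p, ((p ⊗ Id H) ∘ transp B ∘ (Id H ⊗ i)); split=> //.
rewrite /induced_transp_spec.
have xc : (coact B ⊗ Id H) ∘ (transp B ∘ (Id H ⊗ i)) =
    (Id B ⊗ eta H ⊗ Id H) ∘ (transp B ∘ (Id H ⊗ i)).
  diagram (coact_transp B, ext_coact, braid_eta_r H).
by rewrite [RHS](key _ xc); diagram tt.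
Qed.

Variables (p : Hom ⟨B⟩ ⟨A⟩) (sA : Hom ⟨H; A⟩ ⟨A; H⟩).
Hypotheses (pi : p ∘ i = Id A) (sAP : induced_transp_spec i sA).
Let sAE : (i ⊗ Id H) ∘ sA = transp B ∘ (Id H ⊗ i). Proof. exact: sAP. Qed.

Lemma induced_transp_eta : sA ∘ (Id H ⊗ eta A) = eta A ⊗ Id H.
Proof.
have E : (p ⊗ Id H) ∘ (i ⊗ Id H) = hid ⟨A; H⟩ by diagram pi.
apply: (retract_inj E).
diagram (sAE, ext_eta, transp_eta_r B) to ext_eta.
Qed.

Lemma basis_section_transp :
  (phi ⊗ Id H) ∘ hat_transp sA = transp B ∘ (Id H ⊗ phi) ->
  (gamma ⊗ Id H) ∘ braid H = transp B ∘ (Id H ⊗ gamma).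
Proof.
rewrite /hat_transp => phiS.
diagram gammaE to (gammaE, esym phiS, induced_transp_eta).
Qed.

Lemma basis_section_cleft :
  (phi ⊗ Id H) ∘ hat_transp sA = transp B ∘ (Id H ⊗ phi) ->
  iso (conv_map (Delta H) gamma) -> cleft B.
Proof.
move=> phiS Tiso; exists gamma; split.
- exact/(conv_map_iso (coalgebraP H)).
- exact: basis_section_colinear.
exact: basis_section_transp.
Qed.

Section Galois.
Local Notation T := (conv_map (Delta H) gamma).

(** The composite of β with the projection from B ⊗ B to B ⊗_A B. *)
Let beta : Hom ⟨B; B⟩ ⟨B; H⟩ :=
  (mu B ⊗ mu H) ∘ (Id B ⊗ transp B ⊗ Id H) ∘ (Id B ⊗ eta H ⊗ coact B).

Let balance_l : Hom ⟨B; A; B⟩ ⟨B; B⟩ := (mu B ∘ (Id B ⊗ i)) ⊗ Id B.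
Let balance_r : Hom ⟨B; A; B⟩ ⟨B; B⟩ := Id B ⊗ (mu B ∘ (i ⊗ Id B)).

Lemma balanced_kernel (W : lmodType k) (f : {linear tensor B B -> W}) :
  (forall x, f (balance_l x) = f (balance_r x)) ->
  forall g, balanced_relation i g -> f g = 0.
Proof.
move=> fb _ [b a b']; apply/eqP; rewrite linearB subr_eq0; apply/eqP.
have El : balance_l (tens b (tens a b')) = tens (mu B (tens b (i a))) b'.
  rewrite -(tjoin21 b a b') htens_tjoin tjoin11.
  by rewrite -[(_ ∘ _) _]/(mu B ((Id B ⊗ i) (tens b a))) htensE.
have Er : balance_r (tens b (tens a b')) = tens b (mu B (tens (i a) b')).
  rewrite -(tjoin12 b (tens a b')) htens_tjoin tjoin11.
  by rewrite -[(_ ∘ _) _]/(mu B ((i ⊗ Id B) (tens a b'))) htensE.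
by rewrite -El fb Er.
Qed.

(** It sends b ⊗ φ(a ⊗ h) to b i(a) ⊗ h, and induces the inverse of b ⊗ h ↦ b ⊗_A γ(h). *)
Let kappaV : Hom ⟨B; B⟩ ⟨B; H⟩ :=
  (mu B ⊗ Id H) ∘ (Id B ⊗ i ⊗ Id H) ∘ (Id B ⊗ phiV).

Let phiVL : phiV ∘ mu B ∘ (i ⊗ Id B) = (mu A ⊗ Id H) ∘ (Id A ⊗ phiV).
Proof. diagram (esym phiVK, esym phiL, phiK). Qed.

Let kappaV0 g : balanced_relation i g -> kappaV g = 0.
Proof.
apply: balanced_kernel => x.
suff E : kappaV ∘ balance_l = kappaV ∘ balance_r.
  by rewrite -[LHS]/((kappaV ∘ balance_l) x) E.
rewrite /kappaV /balance_l /balance_r.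
diagram (muA B) to (phiVL, ext_mu).
Qed.

(** As i(a) is coinvariant, ν(i(a) b') = (i(a) ⊗ 1) ν(b'). *)
Let beta0 g : balanced_relation i g -> beta g = 0.
Proof.
apply: balanced_kernel => x.
suff E : beta ∘ balance_l = beta ∘ balance_r.
  by rewrite -[LHS]/((beta ∘ balance_l) x) E.
rewrite /beta /balance_l /balance_r.
diagram (transp_eta_l B, mu1l H, muA B) to
  (transp_eta_l B, mu1l H, coact_mu B, ext_coact, transp_eta_l B, mu1l H).
Qed.

Let kappa : {linear tensor B H -> tensorA i} :=
  qproj (balanced_relation i) \o (Id B ⊗ gamma : Hom ⟨B; H⟩ ⟨B; B⟩).

Let kappaE b h : kappa (tens b h) = tensA i b (gamma h).
Proof. by rewrite -[LHS]/(qproj _ ((Id B ⊗ gamma) (tens b h))) htensE. Qed.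

Let kappaK : cancel kappa (qlift kappaV0).
Proof.
move=> x; rewrite -[LHS]/(qlift_fun kappaV (qproj _ ((Id B ⊗ gamma) x))).
rewrite (qlift_proj kappaV0).
suff E : kappaV ∘ (Id B ⊗ gamma) = hid ⟨B; H⟩.
  by rewrite -[LHS]/((kappaV ∘ (Id B ⊗ gamma)) x) E.
rewrite /kappaV; diagram (gammaE, phiK, ext_eta, mu1r B).
Qed.

Let kappaVK : cancel (qlift kappaV0) kappa.
Proof.
move=> x; have [t ->] := qproj_surj x.
rewrite -[LHS]/(kappa (qlift_fun kappaV (qproj _ t))) (qlift_proj kappaV0).
apply: (tens_hom_ext (f := kappa \o kappaV) (g := qproj _)) => b b'.
pose b_ (V : lmodType k) : {linear V -> tensor B V} := linmap (fun a x y => tensPr a b x y).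
pose m : Hom ⟨B; A; H⟩ ⟨B; H⟩ := (mu B ∘ (Id B ⊗ i)) ⊗ Id H.
(* Every b' has the form φ(y), and for y = a ⊗ h, where φ(y) = i(a) γ(h), the claim is the balancing
   relation for a. *)
suff bal y : kappa (m (b_ _ y)) = qproj (balanced_relation i) (b_ _ (phi y)).
  have -> : b' = phi (phiV b') by rewrite -[RHS]/((phi ∘ phiV) b') phiVK.
  rewrite -[RHS]/(qproj _ (b_ _ (phi (phiV b')))) -bal.
  rewrite -[LHS]/(kappa (kappaV (tens b (phi (phiV b'))))); congr (kappa _).
  have -> : kappaV = m ∘ (Id B ⊗ phiV) by rewrite /m /kappaV; diagram tt.
  rewrite -[LHS]/(m ((Id B ⊗ phiV) (tens b (phi (phiV b'))))); congr (m _).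
  rewrite -tjoin11 htens_tjoin -[phiV (phi _)]/((phiV ∘ phi) (phiV b')) phiK.
  exact: (tjoin12 b (phiV b')).
pose F : {linear tensor A H -> tensorA i} := kappa \o (m \o b_ _).
pose G : {linear tensor A H -> tensorA i} := qproj (balanced_relation i) \o (b_ _ \o phi).
rewrite -[LHS]/(F y) -[RHS]/(G y); apply: tens_hom_ext => {y} a h.
rewrite -[LHS]/(kappa (m (tens b (tens a h)))).
rewrite -[RHS]/(qproj _ (tens b (phi (tens a h)))).
rewrite -(tjoin21 b a h) /m htens_tjoin tjoin11 kappaE basis_sectionE.
rewrite -[X in tensA i X]/(mu B ((Id B ⊗ i) (tens b a))) htensE.
rewrite -[X in tens b X]/(mu B ((i ⊗ gamma) (tens a h))) htensE.
by apply/qprojE => S _; apply; apply: Balanced.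
Qed.

Let beta_kappa : beta ∘ (Id B ⊗ gamma) = T.
Proof.
rewrite /beta /conv_map.
diagram (basis_section_colinear, transp_eta_l B, mu1l H).
Qed.

Lemma Galois_conv_map : Galois i <-> iso T.
Proof.
(* Whatever map realizes β, its composite with the bijection [kappa] is T_γ. *)
have TE (bt : {linear tensorA i -> Tens ⟨B; H⟩}) :
    (forall b b', bt (tensA i b b') = beta (tens b b')) -> T =1 bt \o kappa.
  move=> btE; apply: tens_hom_ext => b h.
  rewrite -[RHS]/(bt (kappa (tens b h))) kappaE btE -beta_kappa.
  by rewrite -[LHS]/(beta ((Id B ⊗ gamma) (tens b h))) htensE.
have kappa_bij : bijective kappa by exists (qlift kappaV0).
split=> [[bt btE bt_bij]|/iso_bijective T_bij].
  apply: bijective_iso; apply: eq_bij (fsym (TE _ btE)).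
  exact: bij_comp bt_bij kappa_bij.
have btE b b' : qlift beta0 (tensA i b b') = beta (tens b b') by apply: qlift_proj.
exists (qlift beta0) => //.
apply: (eq_bij (bij_comp T_bij (bij_can_bij kappa_bij kappaK))) => x.
by rewrite -[LHS]/(T (qlift kappaV0 x)) (TE _ btE) -[RHS](congr1 _ (kappaVK x)).
Qed.
End Galois.
End NormalBasis.
End Extension.

(** * Crossed products *)

Section Cocycle.
Variables (k : fieldType) (H : braided_bialgebra k) (A : algebra k).
Variables (B : comodule_algebra H) (i : Hom ⟨A⟩ ⟨B⟩).
Variables (phi : Hom ⟨A; H⟩ ⟨B⟩) (gamma : Hom ⟨H⟩ ⟨B⟩) (sigma : Hom ⟨H; H⟩ ⟨A⟩).
Hypothesis phiE : phi = mu B ∘ (i ⊗ gamma).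
Hypothesis phiL : phi ∘ (mu A ⊗ Id H) = mu B ∘ (i ⊗ phi).
Hypothesis gamma_mu : mu B ∘ (gamma ⊗ gamma) = phi ∘ (sigma ⊗ mu H) ∘ Delta2 H.
Hypothesis phi_iso : iso phi.

Local Notation can := (conv_map (X := H) (Delta H) (Id H)).
Hypothesis can_iso : iso can.

(** Both sides send a ⊗ h ⊗ l to i(a) γ(h) γ(l₁) ⊗ l₂; on the right, γ(h) γ(l₁) appears as expanded
    by [gamma_mu]. *)
Lemma conv_map_cocycle : conv_map (Delta H) gamma ∘ (phi ⊗ Id H) =
  (phi ⊗ Id H) ∘ (Id A ⊗ can) ∘ conv_map2 sigma.
Proof.
rewrite /conv_map /conv_map2.
diagram (phiE, muA B, gamma_mu, esym phiL, Delta2E H, DeltaA H) to (Delta2E H).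
Qed.

Lemma conv_map_cocycle_iso :
  iso (conv_map (Delta H) gamma) <-> iso (conv_map2 sigma).
Proof.
have [phiV phiK phiVK] := phi_iso; have [canV canK canVK] := can_iso.
have phiH : iso (phi ⊗ Id H).
  by exists (phiV ⊗ Id H); [diagram phiK | diagram phiVK].
have phiVH : iso (phiV ⊗ Id H).
  by exists (phi ⊗ Id H); [diagram phiVK | diagram phiK].
have canA : iso (Id A ⊗ can).
  by exists (Id A ⊗ canV); [diagram canK | diagram canVK].
have canVA : iso (Id A ⊗ canV).
  by exists (Id A ⊗ can); [diagram canVK | diagram canK].
split=> Tiso.
  have -> : conv_map2 sigma = (Id A ⊗ canV) ∘ ((phiV ⊗ Id H) ∘
      (conv_map (Delta H) gamma ∘ (phi ⊗ Id H))).
    rewrite conv_map_cocycle; diagram tt to (phiK, canK).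
  exact: (iso_comp (iso_comp (iso_comp phiH Tiso) phiVH) canVA).
have -> : conv_map (Delta H) gamma =
    (phi ⊗ Id H) ∘ ((Id A ⊗ can) ∘ (conv_map2 sigma ∘ (phiV ⊗ Id H))).
  diagram tt to (esym conv_map_cocycle, phiVK).
exact: (iso_comp (iso_comp (iso_comp phiVH Tiso) canA) phiH).
Qed.
End Cocycle.

(** * Cleft extensions *)

Section Cleft.
Variables (k : fieldType) (H : braided_bialgebra k) (A : algebra k).
Variables (B : comodule_algebra H) (i : Hom ⟨A⟩ ⟨B⟩).
Hypothesis ext : H_extension i.
Variables gamma gammaV : Hom ⟨H⟩ ⟨B⟩.
Hypothesis gammaK : mu B ∘ (gamma ⊗ gammaV) ∘ Delta H = eta B ∘ eps H.
Hypothesis gammaVK : mu B ∘ (gammaV ⊗ gamma) ∘ Delta H = eta B ∘ eps H.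
Hypothesis gammaC : coact B ∘ gamma = (gamma ⊗ Id H) ∘ Delta H.
Hypothesis gammaS : (gamma ⊗ Id H) ∘ braid H = transp B ∘ (Id H ⊗ gamma).

Let q : Hom ⟨B⟩ ⟨B⟩ := mu B ∘ (Id B ⊗ gammaV) ∘ coact B.
Let qE : q = mu B ∘ (Id B ⊗ gammaV) ∘ coact B. Proof. by []. Qed.

(** This is b₀ γ⁻¹(b₁) γ(b₂) = b. *)
Let q_gamma : mu B ∘ (q ⊗ gamma) ∘ coact B = Id B.
Proof.
diagram (qE, coact_assoc B, muA B, gammaVK, mu1r B, coact_counit B).
Qed.

Let q_coinvariant : coact B ∘ q = (Id B ⊗ eta H) ∘ q.
Proof.
(* The middle term is q(b₀) ν(γ(b₁) γ⁻¹(b₂)), where q(b₀) ν(γ(b₁)) is ν(b). *)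
transitivity ((mu B ⊗ Id H) ∘
  (q ⊗ (coact B ∘ mu B ∘ (gamma ⊗ gammaV) ∘ Delta H)) ∘ coact B).
  diagram (qE, coact_mu B, coact_assoc B) to
    (coact_mu B, gammaC, esym (muA B), DeltaA H, esym (coact_assoc B), q_gamma).
diagram (gammaK, coact_eta B, mu1r B, coact_counit B).
Qed.

Lemma cleft_projection : exists p, i ∘ p = mu B ∘ (Id B ⊗ gammaV) ∘ coact B.
Proof. exact: (coinvariant_factor ext q_coinvariant). Qed.

(** Uniqueness of inverses: convolved with [gamma] on the left, both sides send h ⊗ l to ε(l) 1 ⊗
    h. *)
Lemma cleft_inverse_transp :
  (gammaV ⊗ Id H) ∘ braid H = transp B ∘ (Id H ⊗ gammaV).
Proof.
pose inner (X : Hom ⟨H; H⟩ ⟨B; H⟩) : Hom ⟨H; H⟩ ⟨B; H⟩ :=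
  (mu B ⊗ Id H) ∘ (gamma ⊗ X) ∘ (braid H ⊗ Id H) ∘ (Id H ⊗ Delta H).
(* [inner X] determines X: multiply it on the left by γ⁻¹. *)
have outer X : X = (mu B ⊗ Id H) ∘ (gammaV ⊗ inner X) ∘
    (braid H ⊗ Id H) ∘ (Id H ⊗ Delta H).
  rewrite /inner; diagram tt to (esym (muA B), esym (DeltaA H),
    esym (braid_Delta_r H), gammaVK, mu1l B, braid_eps_r H, eps1l H).
have innerE : inner ((gammaV ⊗ Id H) ∘ braid H) = inner (transp B ∘ (Id H ⊗ gammaV)).
  rewrite /inner; diagram (esym (braid_Delta_r H), gammaK, braid_eps_r H) to
    (gammaS, esym (transp_mu_r B), gammaK, transp_eta_r B).
by rewrite [LHS]outer innerE -outer.
Qed.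

Section Projection.
Variable p : Hom ⟨B⟩ ⟨A⟩.
Hypothesis ip : i ∘ p = mu B ∘ (Id B ⊗ gammaV) ∘ coact B.

Definition cleft_basis : Hom ⟨A; H⟩ ⟨B⟩ := mu B ∘ (i ⊗ gamma).
Definition cleft_basis_inv : Hom ⟨B⟩ ⟨A; H⟩ := (p ⊗ Id H) ∘ coact B.
Local Notation phi := cleft_basis.
Local Notation phiV := cleft_basis_inv.

Let phiE : phi = mu B ∘ (i ⊗ gamma). Proof. by []. Qed.
Let phiVE : phiV = (p ⊗ Id H) ∘ coact B. Proof. by []. Qed.

(** Since i(a) is coinvariant, the coaction sends i(a) b to i(a) b₀ ⊗ b₁. *)
Lemma projection_mu : p ∘ mu B ∘ (i ⊗ Id B) = mu A ∘ (Id A ⊗ p).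
Proof.
apply: (inj_cancel (ext_inj ext)).
diagram (ip, coact_mu B, ext_coact ext, transp_eta_l B, mu1l H, muA B) to
  (ext_mu ext, ip).
Qed.

Lemma projection_cleft : p ∘ gamma = eta A ∘ eps H.
Proof.
apply: (inj_cancel (ext_inj ext)).
diagram (ip, gammaC, gammaK) to (ext_eta ext).
Qed.

Lemma cleft_basis_colinear : coact B ∘ phi = (phi ⊗ Id H) ∘ (Id A ⊗ Delta H).
Proof.
diagram (phiE, coact_mu B, ext_coact ext, transp_eta_l B, mu1l H, gammaC) to phiE.
Qed.

(** As φ is bijective, this identifies [p] with (A ⊗ ε)φ⁻¹, through which the weak action and the
    cocycle are defined. *)
Lemma projection_basis : p ∘ phi = Id A ⊗ eps H.
Proof. diagram (phiE, projection_mu, projection_cleft, mu1r A). Qed.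

Lemma cleft_basisK : phiV ∘ phi = hid ⟨A; H⟩.
Proof. diagram (phiVE, cleft_basis_colinear, projection_basis, eps1l H). Qed.

Lemma cleft_basis_invK : phi ∘ phiV = Id B.
Proof. diagram (phiE, phiVE, ip, esym qE, q_gamma). Qed.

Lemma cleft_basis_linear : phi ∘ (mu A ⊗ Id H) = mu B ∘ (i ⊗ phi).
Proof. diagram (phiE, ext_mu ext, muA B) to phiE. Qed.

Section Transposition.
Variable sA : Hom ⟨H; A⟩ ⟨A; H⟩.
Hypothesis sAP : induced_transp_spec i sA.
Let sAE : (i ⊗ Id H) ∘ sA = transp B ∘ (Id H ⊗ i). Proof. exact: sAP. Qed.

Lemma cleft_basis_transp : (phi ⊗ Id H) ∘ hat_transp sA = transp B ∘ (Id H ⊗ phi).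
Proof.
rewrite /hat_transp; diagram (phiE, gammaS, sAE) to (phiE, transp_mu_r B).
Qed.

Section Normalized.
Hypothesis gamma1 : gamma ∘ eta H = eta B.

Lemma projection_retraction : p ∘ i = Id A.
Proof.
(* The unit of H is group-like, so the convolution identity evaluated there reads γ(1) γ⁻¹(1) =
   1. *)
have gammaV1 : gammaV ∘ eta H = eta B.
  transitivity (mu B ∘ (gamma ⊗ gammaV) ∘ Delta H ∘ eta H).
    diagram tt to (Delta_eta H, gamma1, mu1l B).
  diagram (gammaK, eps_eta H).
apply: (inj_cancel (ext_inj ext)).
diagram (ip, ext_coact ext, gammaV1, mu1r B).
Qed.
Local Notation pi := projection_retraction.

(** All ingredients of b₀ γ⁻¹(b₁), namely the coaction, γ⁻¹ and the product, are compatible with the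
    transposition. *)
Lemma projection_transp : (p ⊗ Id H) ∘ transp B = sA ∘ (Id H ⊗ p).
Proof.
have E : (p ⊗ Id H) ∘ (i ⊗ Id H) = hid ⟨A; H⟩ by diagram pi.
apply: (retract_inj E).
diagram (ip, coact_transp B, cleft_inverse_transp) to (sAE, ip, transp_mu_r B).
Qed.

Variables (rho : Hom ⟨H; A⟩ ⟨A⟩) (sigma : Hom ⟨H; H⟩ ⟨A⟩).
Hypothesis rhoE : rho = p ∘ mu B ∘ (gamma ⊗ i).
Hypothesis sigmaE : sigma = p ∘ mu B ∘ (gamma ⊗ gamma).

(** The expansion b = i(p(b₀)) γ(b₁) is applied to b = γ(h) i(a), whose coaction is γ(h₁) multiplied
    into (i ⊗ H) s_A(h₂ ⊗ a). *)
Let chiE : mu B ∘ (gamma ⊗ i) =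
  phi ∘ (rho ⊗ Id H) ∘ (Id H ⊗ sA) ∘ (Delta H ⊗ Id A).
Proof.
transitivity (phi ∘ phiV ∘ mu B ∘ (gamma ⊗ i)).
  diagram tt to cleft_basis_invK.
diagram (phiVE, coact_mu B, gammaC, ext_coact ext, esym sAE, mu1r H) to rhoE.
Qed.

(** The same expansion for γ(h) γ(l), where compatibility of [gamma] with the transposition turns s
    into the braid. *)
Lemma cleft_mu : mu B ∘ (gamma ⊗ gamma) = phi ∘ (sigma ⊗ mu H) ∘ Delta2 H.
Proof.
transitivity (phi ∘ phiV ∘ mu B ∘ (gamma ⊗ gamma)).
  diagram tt to cleft_basis_invK.
diagram (phiVE, coact_mu B, gammaC, gammaC, esym gammaS) to (sigmaE, Delta2E H).
Qed.
Local Notation FE := cleft_mu.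

Lemma cleft_weak_action : weak_action sA rho.
Proof.
split.
- diagram (rhoE, gamma1, mu1l B, pi).
- diagram (rhoE, ext_eta ext, mu1r B, projection_cleft).
- diagram (rhoE, esym projection_transp, transp_mu_r B, esym gammaS, esym sAE) to rhoE.
(* In (γ(h) i(a)) i(b) the inner product is expanded by [chiE], after which left linearity of [p]
   splits off the first action. *)
diagram (rhoE, ext_mu ext, esym (muA B), chiE, phiE, muA B, projection_mu, esym rhoE).
Qed.

Lemma cleft_compatible : compatible_transp sA sigma.
Proof.
rewrite /compatible_transp.
diagram sigmaE to
  (sigmaE, esym projection_transp, transp_mu_r B, esym gammaS, esym gammaS).
Qed.

Lemma cleft_crossed_system : crossed_system sA rho sigma.
Proof.
have weak := cleft_weak_action; have comp := cleft_compatible.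
split=> //.
- split; first diagram (sigmaE, gamma1, mu1l B, projection_cleft).
  diagram (sigmaE, gamma1, mu1r B, projection_cleft).
- have Delta3E : Delta3 H = (Id H ⊗ Id H ⊗ braid H ⊗ Id H ⊗ Id H) ∘
    (Id H ⊗ braid H ⊗ braid H ⊗ Id H) ∘ (Delta H ⊗ Delta H ⊗ Delta H) by [].
  (* Bracketing γ(h) γ(l) γ(m) to the right yields the left-hand side of the cocycle condition,
     bracketing to the left its right-hand side. *)
  transitivity (p ∘ mu B ∘ (mu B ⊗ Id B) ∘ (gamma ⊗ gamma ⊗ gamma)).
    rewrite /compatible_transp in comp.
    diagram Delta3E to (muA B, FE, phiE, esym (muA B), chiE, phiE, muA B,
      projection_mu, esym sigmaE, esym comp, Delta2E H).
  diagram (FE, phiE, muA B, projection_mu, esym sigmaE).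
(* Likewise γ(h) (γ(l) i(a)) yields the side with two actions and (γ(h) γ(l)) i(a) the side with
   one. *)
transitivity (p ∘ mu B ∘ (mu B ⊗ Id B) ∘ (gamma ⊗ gamma ⊗ i)).
  have [_ _ rhoS _] := weak.
  diagram (Delta2E H) to (muA B, chiE, phiE, esym (muA B), chiE, phiE, muA B,
    projection_mu, esym sigmaE, rhoS).
diagram (FE, phiE, muA B, projection_mu, esym rhoE).
Qed.

Lemma cleft_basis_isomorphism :
  @comodule_algebra_isomorphism k H (crossed_product sA rho sigma) (data_of B) phi.
Proof.
split; last first.
  by apply: iso_bijective; exists phiV; [exact: cleft_basisK | exact: cleft_basis_invK].
split.
(* The crossed multiplication is i(a) γ(h) i(b) γ(l) with the inner pair reordered by [chiE] and the
   two values of [gamma] then merged by [FE]. *)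
- rewrite /= /crossed_mu /crossed_F /crossed_chi.
  diagram (cleft_basis_linear, ext_mu ext, esym FE) to
    (phiE, phiE, muA B, esym (muA B), chiE, phiE, muA B, esym (muA B)).
- rewrite /=; diagram (phiE, ext_eta ext, gamma1, mu1l B).
- exact: cleft_basis_colinear.
exact: cleft_basis_transp.
Qed.

Lemma cleft_actionE : i ∘ rho = mu B ∘ (mu B ⊗ Id B) ∘ (gamma ⊗ i ⊗ gammaV) ∘
  (Id H ⊗ sA) ∘ (Delta H ⊗ Id A).
Proof.
diagram (rhoE, ip, coact_mu B, gammaC, ext_coact ext, esym sAE, mu1r H).
Qed.

Lemma cleft_cocycleE : i ∘ sigma = mu B ∘ (mu B ⊗ gammaV) ∘
  (gamma ⊗ gamma ⊗ mu H) ∘ Delta2 H.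
Proof.
diagram (sigmaE, ip, coact_mu B, gammaC, gammaC, esym gammaS) to (Delta2E H).
Qed.
End Normalized.
End Transposition.
End Projection.
End Cleft.

(** * The equivalences *)

Section Normalization.
Variables (k : fieldType) (H : braided_bialgebra k) (B : comodule_algebra H).

(** The element γ(1) has the inverse γ⁻¹(1), and the latter is coinvariant, so h ↦ γ⁻¹(1) γ(h) is
    still colinear and takes 1 to 1. *)
Lemma cleft_normalize : cleft B -> exists2 gamma : Hom ⟨H⟩ ⟨B⟩,
  cleft_map gamma & gamma ∘ eta H = eta B.
Proof.
case=> gamma [[gammaV []]]; rewrite /convol => gammaK gammaVK gammaC gammaS.
have gammaVS := cleft_inverse_transp gammaK gammaVK gammaS.
have unitK : mu B ∘ (gamma ⊗ gammaV) ∘ (eta H ⊗ eta H) = eta B.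
  transitivity (mu B ∘ (gamma ⊗ gammaV) ∘ Delta H ∘ eta H).
    diagram tt to (Delta_eta H).
  diagram (gammaK, eps_eta H).
have unitVK : mu B ∘ (gammaV ⊗ gamma) ∘ (eta H ⊗ eta H) = eta B.
  transitivity (mu B ∘ (gammaV ⊗ gamma) ∘ Delta H ∘ eta H).
    diagram tt to (Delta_eta H).
  diagram (gammaVK, eps_eta H).
(* The inverse of a coinvariant unit is coinvariant: γ⁻¹(1) is multiplied into the coaction of γ(1)
   γ⁻¹(1) = 1. *)
have unitC : coact B ∘ gammaV ∘ eta H = (gammaV ∘ eta H) ⊗ eta H.
  transitivity ((mu B ⊗ Id H) ∘ ((gammaV ∘ eta H) ⊗
      (coact B ∘ mu B ∘ (gamma ⊗ gammaV) ∘ (eta H ⊗ eta H)))).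
    diagram tt to (coact_mu B, gammaC, Delta_eta H, transp_eta_l B, mu1l H,
      esym (muA B), unitVK, mu1l B).
  diagram (unitK, coact_eta B, mu1r B).
pose gamma' : Hom ⟨H⟩ ⟨B⟩ := mu B ∘ ((gammaV ∘ eta H) ⊗ gamma).
pose gammaV' : Hom ⟨H⟩ ⟨B⟩ := mu B ∘ (gammaV ⊗ (gamma ∘ eta H)).
exists gamma'; last by rewrite /gamma'; diagram unitVK.
split; rewrite /gamma'.
- exists gammaV'; split; rewrite /convol /gammaV'.
    diagram (muA B, esym (muA B), gammaK, mu1l B) to (esym unitVK).
  diagram (muA B, esym (muA B), unitK, mu1l B, gammaVK).
- diagram (coact_mu B, unitC, transp_eta_l B, mu1l H, gammaC).
diagram gammaS to (transp_mu_r B, esym gammaVS, braid_eta_r H).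
Qed.
End Normalization.

Section Equivalences.
Variables (k : fieldType) (H : braided_bialgebra k) (A : algebra k).
Variables (B : comodule_algebra H) (i : Hom ⟨A⟩ ⟨B⟩).
Hypothesis ext : H_extension i.
Local Notation sA := (induced_transp i).

Lemma cleft_basis_section (gamma : Hom ⟨H⟩ ⟨B⟩) :
  basis_section (cleft_basis i gamma) = gamma.
Proof. rewrite /basis_section /cleft_basis; diagram (ext_eta ext, mu1l B). Qed.

Lemma cleft_normal_basis (gamma : Hom ⟨H⟩ ⟨B⟩) : cleft_map gamma ->
  [/\ induced_transp_spec i sA, Galois i & normal_basis i (cleft_basis i gamma)].
Proof.
case=> inv gammaC gammaS; have [gammaV []] := inv.
rewrite /convol => gammaK gammaVK.
have [p ip] := cleft_projection ext gammaK gammaVK gammaC.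
have phiK := cleft_basisK ext gammaK gammaC ip.
have phiVK := cleft_basis_invK gammaVK ip.
have phiL := cleft_basis_linear ext gamma.
have phiC := cleft_basis_colinear ext gammaC.
have [r [s0 [_ s0P]]] := transp_exists ext phiK phiVK phiL phiC.
have sAP : induced_transp_spec i sA by apply: induced_transpP; exists s0.
split=> //.
  apply/(Galois_conv_map ext phiK phiVK phiL phiC); rewrite cleft_basis_section.
  exact/(conv_map_iso (coalgebraP H)).
split=> //; first by apply: iso_bijective; exists (cleft_basis_inv p).
exact: cleft_basis_transp.
Qed.

Lemma Galois_cleft (phi : Hom ⟨A; H⟩ ⟨B⟩) : Galois i -> normal_basis i phi -> cleft B.
Proof.
move=> gal [/bijective_iso[phiV phiK phiVK] phiL phiC phiS].
have [p [s0 [pi s0P]]] := transp_exists ext phiK phiVK phiL phiC.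
have sAP : induced_transp_spec i sA by apply: induced_transpP; exists s0.
apply: (basis_section_cleft ext phiC pi sAP phiS).
exact/(Galois_conv_map ext phiK phiVK phiL phiC).
Qed.

Hypothesis can_iso : iso (conv_map (X := H) (Delta H) (Id H)).

Lemma crossed_cleft (rho : Hom ⟨H; A⟩ ⟨A⟩) (sigma : Hom ⟨H; H⟩ ⟨A⟩)
    (f : Hom ⟨B⟩ ⟨A; H⟩) :
  crossed_system sA rho sigma -> cocycle_invertible sigma ->
  @comodule_algebra_isomorphism k H (data_of B) (crossed_product sA rho sigma) f ->
  left_A_linear i f -> cleft B.
Proof.
case=> -[_ rho1 _ _] _ _ _ _ sigma_inv [[/= fM _ fC fS] f_bij] fL.
(* The normal basis is the inverse of the given isomorphism. *)
have [phi phiVK phiK] : iso f by apply: bijective_iso.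
rewrite /crossed_mu /crossed_F /crossed_chi in fM.
rewrite /left_A_linear in fL.
rewrite /hat_transp in fS.
have phiL : phi ∘ (mu A ⊗ Id H) = mu B ∘ (i ⊗ phi).
  apply: (retract_inj phiVK); diagram phiK to (fL, phiK).
have phiC : coact B ∘ phi = (phi ⊗ Id H) ∘ (Id A ⊗ Delta H).
  diagram tt to (esym phiK, fC, phiVK).
have phiS : (phi ⊗ Id H) ∘ hat_transp sA = transp B ∘ (Id H ⊗ phi).
  rewrite /hat_transp; diagram (esym phiK, esym fS, phiVK).
have [p [s0 [pi s0P]]] := transp_exists ext phiK phiVK phiL phiC.
have sAP : induced_transp_spec i sA by apply: induced_transpP; exists s0.
apply: (basis_section_cleft ext phiC pi sAP phiS).
have phiE := basis_sectionE phiL.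
have phi_iso : iso phi by exists f.
have sA1 := induced_transp_eta ext pi sAP.
(* In the crossed product, χ(h ⊗ 1) = 1 ⊗ h, so the product of 1 ⊗ h and 1 ⊗ l is F(h ⊗ l). *)
have gamma_mu : mu B ∘ (basis_section phi ⊗ basis_section phi) =
    phi ∘ (sigma ⊗ mu H) ∘ Delta2 H.
  apply: (retract_inj phiVK); rewrite /basis_section.
  diagram (fM, phiK, phiK, sA1, rho1, eps1l H, mu1l A, mu1l A) to phiK.
apply/(conv_map_cocycle_iso phiE phiL gamma_mu phi_iso can_iso).
exact/conv_map2_iso.
Qed.

Lemma cleft_crossed : cleft B ->
  exists (rho : Hom ⟨H; A⟩ ⟨A⟩) (sigma : Hom ⟨H; H⟩ ⟨A⟩),
    [/\ crossed_system sA rho sigma, cocycle_invertible sigma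
      & exists2 f : Hom (data_of B) (crossed_product sA rho sigma),
          comodule_algebra_isomorphism f & left_A_linear i f].
Proof.
(* A unital cleft map makes the cocycle normal and lets 1 act on A as the identity. *)
case/cleft_normalize=> gamma cl gamma1.
have [sAP _ [_ phiL phiC phiS]] := cleft_normal_basis cl.
have [inv gammaC gammaS] := cl; have [gammaV []] := inv.
rewrite /convol => gammaK gammaVK.
have [p ip] := cleft_projection ext gammaK gammaVK gammaC.
have phiK := cleft_basisK ext gammaK gammaC ip.
have phiVK := cleft_basis_invK gammaVK ip.
set phi := cleft_basis i gamma in phiL phiC phiS phiK phiVK *.
set phiV := cleft_basis_inv p in phiK phiVK *.
pose rho : Hom ⟨H; A⟩ ⟨A⟩ := p ∘ mu B ∘ (gamma ⊗ i).
pose sigma : Hom ⟨H; H⟩ ⟨A⟩ := p ∘ mu B ∘ (gamma ⊗ gamma).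
have [[/= phiM phi1 _ _] _] := cleft_basis_isomorphism ext gammaK gammaVK gammaC gammaS ip sAP
  gamma1 (erefl rho) (erefl sigma).
rewrite -/phi in phiM phi1.
exists rho, sigma; split.
- exact: (cleft_crossed_system ext gammaK gammaVK gammaC gammaS ip sAP gamma1).
- have phi_iso : iso phi by exists phiV.
  have gamma_mu := cleft_mu gammaVK gammaC gammaS ip (erefl sigma).
  apply/conv_map2_iso.
  apply/(conv_map_cocycle_iso (erefl phi) phiL gamma_mu phi_iso can_iso).
  exact/(conv_map_iso (coalgebraP H)).
exists phiV.
  split; last by apply: iso_bijective; exists phi.
  split=> /=.
  - apply: (retract_inj phiK); diagram phiVK to (phiM, phiVK, phiVK).
  - apply: (retract_inj phiK); diagram phiVK to phi1.
  - diagram tt to (esym phiVK, phiC, phiK).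
  rewrite /hat_transp in phiS *.
  diagram (esym phiVK, esym phiS, phiK).
rewrite /left_A_linear; apply: (retract_inj phiK).
diagram phiVK to (phiL, phiVK).
Qed.

Lemma cleft_explicit (gamma : Hom ⟨H⟩ ⟨B⟩) :
  cleft_map gamma -> gamma ∘ eta H = eta B ->
  let phi : Hom ⟨A; H⟩ ⟨B⟩ := mu B ∘ (i ⊗ gamma) in
  normal_basis i phi /\
  forall (phiV : Hom ⟨B⟩ ⟨A; H⟩) (gammaV : Hom ⟨H⟩ ⟨B⟩),
    cancel phi phiV -> cancel phiV phi ->
    conv_inverse (Delta H) (eps H) gamma gammaV ->
    let rho : Hom ⟨H; A⟩ ⟨A⟩ := (Id A ⊗ eps H) ∘ phiV ∘ mu B ∘ (gamma ⊗ i) in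
    let sigma : Hom ⟨H; H⟩ ⟨A⟩ := (Id A ⊗ eps H) ∘ phiV ∘ mu B ∘ (gamma ⊗ gamma) in
    [/\ crossed_system sA rho sigma,
        @comodule_algebra_isomorphism k H (crossed_product sA rho sigma) (data_of B) phi,
        i ∘ rho = mu B ∘ (mu B ⊗ Id B) ∘ (gamma ⊗ i ⊗ gammaV) ∘
                  (Id H ⊗ sA) ∘ (Delta H ⊗ Id A)
      & i ∘ sigma = mu B ∘ (mu B ⊗ gammaV) ∘ (gamma ⊗ gamma ⊗ mu H) ∘ Delta2 H].
Proof.
move=> cl gamma1 phi; have [sAP _ nb] := cleft_normal_basis cl; split=> //.
have [_ gammaC gammaS] := cl.
move=> phiV gammaV phiK phiVK [gammaK gammaVK] rho sigma.
rewrite /convol in gammaK gammaVK.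
have [p ip] := cleft_projection ext gammaK gammaVK gammaC.
have pE : (Id A ⊗ eps H) ∘ phiV = p.
  have pphi : p ∘ phi = _ := projection_basis ext gammaK gammaC ip.
  have phiVK' : phi ∘ phiV = hid ⟨B⟩ := hcancel phiVK.
  diagram tt to (esym phiVK', pphi).
have rhoE : rho = p ∘ mu B ∘ (gamma ⊗ i) by rewrite /rho pE.
have sigmaE : sigma = p ∘ mu B ∘ (gamma ⊗ gamma) by rewrite /sigma pE.
split.
- exact: (cleft_crossed_system ext gammaK gammaVK gammaC gammaS ip sAP gamma1).
- exact: (cleft_basis_isomorphism ext gammaK gammaVK gammaC gammaS ip sAP gamma1).
- exact: (cleft_actionE ext gammaC ip sAP rhoE).
exact: (cleft_cocycleE gammaC gammaS ip sigmaE).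
Qed.
End Equivalences.

Theorem theorem1p36 (k : fieldType) (H : braided_Hopf k)
    (A : algebra k) (B : comodule_algebra H) (i : Hom ⟨A⟩ ⟨B⟩)
    (ext : H_extension i) :
  let sA := induced_transp i in
  [/\ cleft B <-> (Galois i /\ exists phi, normal_basis i phi),
      cleft B <->
        (exists (rho : Hom ⟨H; A⟩ ⟨A⟩) (sigma : Hom ⟨H; H⟩ ⟨A⟩),
          [/\ crossed_system sA rho sigma,
              cocycle_invertible sigma
            & exists2 f : Hom (data_of B) (crossed_product sA rho sigma),
                comodule_algebra_isomorphism f & left_A_linear i f])
    & forall gamma : Hom ⟨H⟩ ⟨B⟩, cleft_map gamma -> gamma (alg_one H) = alg_one B ->
        let phi : Hom ⟨A; H⟩ ⟨B⟩ := mu B ∘ (i ⊗ gamma) in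
        normal_basis i phi /\
        forall (phiV : Hom ⟨B⟩ ⟨A; H⟩) (gammaV : Hom ⟨H⟩ ⟨B⟩),
          cancel phi phiV -> cancel phiV phi ->
          conv_inverse (Delta H) (eps H) gamma gammaV ->
          let rho : Hom ⟨H; A⟩ ⟨A⟩ :=
            (Id A ⊗ eps H) ∘ phiV ∘ mu B ∘ (gamma ⊗ i) in
          let sigma : Hom ⟨H; H⟩ ⟨A⟩ :=
            (Id A ⊗ eps H) ∘ phiV ∘ mu B ∘ (gamma ⊗ gamma) in
          [/\ crossed_system sA rho sigma,
              @comodule_algebra_isomorphism k H (crossed_product sA rho sigma) (data_of B) phi,
              i ∘ rho = mu B ∘ (mu B ⊗ Id B) ∘ (gamma ⊗ i ⊗ gammaV) ∘
                        (Id H ⊗ sA) ∘ (Delta H ⊗ Id A)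
            & i ∘ sigma = mu B ∘ (mu B ⊗ gammaV) ∘ (gamma ⊗ gamma ⊗ mu H) ∘
                          Delta2 H]].
Proof.
have can_iso : iso (conv_map (X := H) (Delta H) (Id H)).
  exact/(conv_map_iso (coalgebraP H))/antipodeP.
split.
- split=> [[gamma /(cleft_normal_basis ext)[_ gal nb]]|[gal [phi nb]]].
    by split=> //; exists (cleft_basis i gamma).
  exact: (Galois_cleft ext gal nb).
- split=> [|[rho [sigma [sys inv [f fiso fL]]]]]; first exact: cleft_crossed.
  exact: (crossed_cleft ext can_iso sys inv fiso fL).
move=> gamma cl gamma1; apply: (cleft_explicit ext cl).
exact: scalar_ext.
Qed.
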